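(* Let $c\in\mathbb{R}$ and let $f$ be a real-valued function that is odd about $c$ and such that the integral $\int_c^{c+\delta}|f(t)|\,|t-c|\,dt$ exists for some $\delta>0$. Define the Fourier transform of $f$ by the principal value integral $\hat f(s)=\int_{c-\delta}^{c+\delta}e^{-ist}f(t)\,dt$ for $s\in\mathbb{R}$. Suppose $x\in\mathbb{R}$, $x\notin[c-\delta,c+\delta]$, and define $T_n=\frac{(2n+1)\pi}{2|x-c|}$ for $n\in\mathbb{N}$. Then $$\lim_{\substack{n\to\infty\\ S\to0^+}}\int_{S<|s|<T_n}e^{ixs}\hat f(s)\,ds=0.$$
   Context: Odd about $c$ means $f(c-u)=-f(c+u)$ for $0<u\leq\delta$. The integral of $|f(t)||t-c|$ is a Lebesgue integral (finite, with $f$ measurable). The principal value integral is $\lim_{\epsilon\to0^+}\left(\int_{c-\delta}^{c-\epsilon}+\int_{c+\epsilon}^{c+\delta}\right)e^{-ist}f(t)\,dt$. The limit $S\to0^+$ is taken through real numbers, independently of $n\to\infty$. *)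

(* Defs.v *)
From mathcomp Require Import all_boot all_order all_algebra.
From mathcomp Require Import all_classical all_reals all_analysis.
From mathcomp Require Import complex.

Set Implicit Arguments.
Unset Strict Implicit.
Unset Printing Implicit Defensive.

Import Order.TTheory GRing.Theory Num.Theory.
Import numFieldNormedType.Exports.

Local Open Scope classical_set_scope.
Local Open Scope ring_scope.
Local Open Scope complex_scope.

(* The completed measure makes "measurable" mean Lebesgue measurable, whereas
   [lebesgue_measure] lives on the Borel sigma-algebra. [LebT R] is [R] itself,
   equipped with the Lebesgue-measurable sets. *)
Notation LebT R := (caratheodory_type (@wlength R idfun)^*%mu).
Notation Leb R := (@completed_lebesgue_measure R).

(* The exponential e^(i t) of a real t. *)
Definition expi (R : realType) (t : R) : R[i] := cos t +i* sin t.

Definition cintegrable d (T : measurableType d) (R : realType)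
    (mu : {measure set T -> \bar R}) (A : set T) (g : T -> R[i]) : Prop :=
  mu.-integrable A (fun t => (complex.Re (g t))%:E) /\
  mu.-integrable A (fun t => (complex.Im (g t))%:E).

Definition cintegral d (T : measurableType d) (R : realType)
    (mu : {measure set T -> \bar R}) (A : set T) (g : T -> R[i]) : R[i] :=
  Rintegral mu A (fun t => complex.Re (g t)) +i*
  Rintegral mu A (fun t => complex.Im (g t)).

Definition odd_about (R : realType) (c delta : R) (f : R -> R) : Prop :=
  forall u, 0 < u <= delta -> f (c - u) = - f (c + u).

Definition fourier_integrand (R : realType) (f : R -> R) (s t : R) : R[i] :=
  expi (- (s * t)) * (f t)%:C.

Definition fourier_trunc (R : realType) (f : R -> R) (c delta s eps : R) :
    R[i] :=
  cintegral (Leb R) `[c - delta, c - eps]%classic (fourier_integrand f s) +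
  cintegral (Leb R) `[c + eps, c + delta]%classic (fourier_integrand f s).

(* The normed topology of the complex numbers is carried by the alias
   [R[i]^o]. *)
Definition fourier_pv (R : realType) (f : R -> R) (c delta s : R) : R[i] :=
  lim (fourier_trunc f c delta s eps @[eps --> 0^'+] : set_system R[i]^o).

(* [lim] and [Rintegral] return junk values when the limit or the integral
   does not exist; this says that neither is the case in [fourier_pv]. *)
Definition fourier_pv_exists (R : realType) (f : R -> R) (c delta s : R) :
    Prop :=
  (forall eps, 0 < eps ->
     cintegrable (Leb R) `[c - delta, c - eps]%classic
       (fourier_integrand f s) /\
     cintegrable (Leb R) `[c + eps, c + delta]%classic
       (fourier_integrand f s)) /\
  (fourier_trunc f c delta s eps @[eps --> 0^'+] -->
     (fourier_pv f c delta s : R[i]^o)).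

Definition inversion_integrand (R : realType) (f : R -> R) (c delta x s : R) :
    R[i] :=
  expi (x * s) * fourier_pv f c delta s.

Definition symmetric_shell (R : realType) (S T : R) : set R :=
  [set s | S < `|s| < T].

Definition cutoff (R : realType) (c x : R) (n : nat) : R :=
  (2 * n + 1)%N%:R * pi / (2 * `|x - c|).

(* Main.v *)
Require Import Defs.
From mathcomp Require Import all_boot all_order all_algebra.
From mathcomp Require Import all_classical all_reals all_analysis.
From mathcomp Require Import ring lra measurable_realfun complex.

Import Order.TTheory GRing.Theory Num.Theory.
Import numFieldNormedType.Exports.

Local Open Scope classical_set_scope.
Local Open Scope ring_scope.
Local Open Scope complex_scope.

(** Write [y = x - c], so that [delta < `|y|], and [u = t - c]. Reflecting the
left half of the principal value about [c] and using oddness turns the Fourier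
transform into a sine transform,
  [f^(s) = - 2 i e^(- i s c) F(s)],
  [F(s) = \int_c^(c + delta) sin (s (t - c)) f(t) dt],
and [`|sin (s u)| <= `|s| u] makes this integral absolutely convergent: the
singularity allowed at [c] is cancelled by the zero of the sine
([fourier_trunc_odd], [fourier_pv_odd]).

The inversion integrand is then [(2 sin (y s) - 2 i cos (y s)) F(s)]. As [F] is
odd, its imaginary part integrates to zero over a symmetric shell. In the real
part Fubini's theorem ([sine_transform_fubini]) leaves the inner integral of
[2 sin (y s) sin (u s)] over [S < `|s| < T], which is [2 (G(T) - G(S))] for the
explicit primitive
  [G(s) = 2 (u sin (y s) cos (u s) - y cos (y s) sin (u s)) / (y^2 - u^2)].
The cutoffs [T_n] are the points with [cos (y T_n) = 0], where the second term of
[G] disappears and the first one contains the factor [u] that makes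
[f(t) u / (y^2 - u^2)] integrable. The upper endpoint therefore contributes a
multiple, bounded in [n], of the integral of [f(t) u / (y^2 - u^2)] against
[cos (T_n u)], while [`|G(S)| <= C S u] makes the lower endpoint [O(S)] uniformly
in [n] ([Rintegral_shell_sine_transform_le]). Hence both limits may be taken
independently of each other.

The first contribution tends to zero by a Riemann-Lebesgue argument which is
special to the frequencies [T_n]. Because [cos (T_n `|y|) = 0], the functions
[cos (T_n u)] are pairwise orthogonal on [0 <= u <= `|y|], an interval that
contains the support [0 <= u <= delta] of the integrand; and the coefficients of
an integrable function in a uniformly bounded orthogonal system tend to zero, by
Bessel's inequality for bounded functions and truncation in general
([bounded_coef_cvg0], [integrable_coef_cvg0]). This argument works on any finite
measure space, so it applies to Lebesgue measurable functions as they are,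
without approximating them by step functions or continuous functions. *)

(** * Integrability, and Fubini's theorem for real-valued integrals *)

Lemma le_integrable_EFin d (T : measurableType d) (R : realType)
    (mu : {measure set T -> \bar R}) (D : set T) (g h : T -> R) :
  measurable D -> measurable_fun D g ->
  (forall t, D t -> `|g t| <= h t) ->
  mu.-integrable D (EFin \o h) -> mu.-integrable D (EFin \o g).
Proof.
move=> mD mg gh; apply: le_integrable => //; first exact/measurable_EFinP.
by move=> t Dt /=; rewrite lee_fin (le_trans (gh t Dt))// ler_norm.
Qed.

Lemma bounded_integrable d (T : measurableType d) (R : realType)
    (mu : {measure set T -> \bar R}) (D : set T) (g : T -> R) (K : R) :
  measurable D -> (mu D < +oo)%E -> measurable_fun D g ->
  (forall t, D t -> `|g t| <= K) -> mu.-integrable D (EFin \o g).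
Proof.
move=> mD Doo mg gK; apply: measurable_bounded_integrable => //.
exists K; split; first exact: num_real.
by move=> z Kz t Dt; exact: le_trans (gK t Dt) (ltW Kz).
Qed.

(** The domination by a product of integrable functions makes every section
integrable, so that each inner integral is a genuine real number and the
extended-real Fubini theorem can be read on real-valued integrals. *)
Lemma Rintegral_fubini d1 d2 (T1 : measurableType d1) (T2 : measurableType d2)
    (R : realType) (m1 : {sigma_finite_measure set T1 -> \bar R})
    (m2 : {sigma_finite_measure set T2 -> \bar R})
    (phi : T1 * T2 -> R) (a : T1 -> R) (b : T2 -> R) :
  measurable_fun setT phi ->
  (forall x y, `|phi (x, y)| <= a x * b y) ->
  m1.-integrable setT (EFin \o a) -> m2.-integrable setT (EFin \o b) ->
  measurable_fun setT (fun x => Rintegral m2 setT (fun y => phi (x, y))) /\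
  Rintegral m1 setT (fun x => Rintegral m2 setT (fun y => phi (x, y))) =
  Rintegral m2 setT (fun y => Rintegral m1 setT (fun x => phi (x, y))).
Proof.
move=> mphi phib ia ib.
have i2 x : m2.-integrable setT (EFin \o (fun y => phi (x, y))).
  apply: (@le_integrable _ _ _ m2 setT _ _ (fun y => (a x)%:E * (b y)%:E)%E) => //.
  - apply/measurable_EFinP; apply: measurableT_comp mphi _.
    exact: measurable_pair1.
  - by move=> y _ /=; rewrite lee_fin (le_trans (phib x y))// ler_norm.
  - exact: integrableZl.
have i1 y : m1.-integrable setT (EFin \o (fun x => phi (x, y))).
  apply: (@le_integrable _ _ _ m1 setT _ _ (fun x => (b y)%:E * (a x)%:E)%E) => //.
  - apply/measurable_EFinP; apply: measurableT_comp mphi _.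
    exact: measurable_pair2.
  - by move=> x _ /=; rewrite lee_fin (le_trans (phib x y))// mulrC ler_norm.
  - exact: integrableZl.
have E2 x : (Rintegral m2 setT (fun y => phi (x, y)))%:E =
    (\int[m2]_y (EFin \o phi) (x, y))%E.
  by rewrite /Rintegral fineK//; exact: integrable_fin_num (i2 x).
have E1 y : (Rintegral m1 setT (fun x => phi (x, y)))%:E =
    (\int[m1]_x (EFin \o phi) (x, y))%E.
  by rewrite /Rintegral fineK//; exact: integrable_fin_num (i1 y).
have mphiE : measurable_fun setT (EFin \o phi) by exact/measurable_EFinP.
have iphi : (m1 \x m2)%E.-integrable setT (EFin \o phi).
  apply/integrable12ltyP => //.
  apply: (@le_lt_trans _ _ (\int[m1]_x (`|(a x)%:E| *  \int[m2]_y `|(b y)%:E|))%E).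
    apply: ge0_le_integral => //.
    + by move=> x _; exact: integral_ge0.
    + apply: (measurable_fun_fubini_tonelli_F (m2 := m2)
        (fun z => `|(EFin \o phi) z|%E)) => //.
      exact: measurableT_comp.
    + apply: emeasurable_funM => //.
      by apply: measurableT_comp => //; exact: measurable_int ia.
    + move=> x _; rewrite -ge0_integralZl//; last first.
        by apply: measurableT_comp => //; exact: measurable_int ib.
      apply: ge0_le_integral => //.
      * by apply: measurableT_comp => //; exact: measurable_int (i2 x).
      * apply: emeasurable_funM => //.
        by apply: measurableT_comp => //; exact: measurable_int ib.
      * move=> y _ /=; rewrite lee_fin (le_trans (phib x y))//.
        by rewrite -normrM ler_norm.
  have /integrableP[_ boo] := ib; have /integrableP[ma aoo] := ia.
  rewrite ge0_integralZr//; [|exact: measurableT_comp|exact: integral_ge0].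
  apply: lte_mul_pinfty => //; first exact: integral_ge0.
  by rewrite ge0_fin_numE//; exact: integral_ge0.
split.
  apply/measurable_EFinP; rewrite (_ : _ \o _ = fubini_F m2 (EFin \o phi)).
    exact: (measurable_fubini_F iphi).
  by apply/funext => x; exact: E2.
rewrite /Rintegral; congr fine.
under eq_integral do rewrite E2.
under [RHS]eq_integral do rewrite E1.
exact: Fubini.
Qed.

(** * Coefficients of an integrable function in a bounded orthogonal system *)

(** Bessel's inequality without normalization: with [w] an upper bound for all
the squared norms of the [e n], subtracting [a n / w] times [e n] from [h], one
index after the other, lowers the squared norm of the remainder by at least
[a n ^+ 2 / w]. The series of squared coefficients is therefore bounded. Bounded
functions keep every product involved integrable. *)
Lemma bounded_coef_cvg0 d (T : measurableType d) (R : realType)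
    (mu : {measure set T -> \bar R}) (D : set T) (h : T -> R)
    (e : nat -> T -> R) (M B : R) :
  measurable D -> (mu D < +oo)%E -> measurable_fun D h ->
  (forall n, measurable_fun D (e n)) ->
  (forall t, D t -> `|h t| <= M) ->
  (forall n t, D t -> `|e n t| <= B) ->
  (forall m n, m != n -> Rintegral mu D (fun t => e m t * e n t) = 0) ->
  Rintegral mu D (fun t => h t * e n t) @[n --> \oo] --> (0 : R).
Proof.
move=> mD Doo mh me hM eB orth.
(* On a set of finite measure these functions form an algebra of integrable
   functions. *)
pose bm (g : T -> R) := measurable_fun D g /\
  exists K, forall t, D t -> `|g t| <= K.
have bmi g : bm g -> mu.-integrable D (EFin \o g).
  by move=> [mg [K gK]]; exact: (bounded_integrable _ _ _ _ _ _ K).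
have bmD f g : bm f -> bm g -> bm (fun t => f t + g t).
  move=> [mf [K fK]] [mg [L gL]]; split; first exact: measurable_funD.
  exists (K + L) => t Dt; apply: (le_trans (ler_normD _ _)).
  by apply: lerD; [exact: fK|exact: gL].
have bmM f g : bm f -> bm g -> bm (fun t => f t * g t).
  move=> [mf [K fK]] [mg [L gL]]; split; first exact: measurable_funM.
  exists (K * L) => t Dt; rewrite normrM.
  by apply: ler_pM => //; [exact: fK|exact: gL].
have bmZ (k : R) g : bm g -> bm (fun t => k * g t).
  by apply: bmM; split; [exact: measurable_cst|exists `|k|].
have bme n : bm (e n) by split; [exact: me|exists B; exact: eB].
have bmh : bm h by split => //; exists M.
pose a n := Rintegral mu D (fun t => h t * e n t).
(* The summand 1 keeps [w] positive when [D] is negligible or [B = 0]. *)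
pose w : R := Rintegral mu D (fun _ => B ^+ 2) + 1.
have w0 : 0 < w.
  by rewrite ltr_wpDl// Rintegral_ge0// => t _; rewrite sqr_ge0.
have ew n : Rintegral mu D (fun t => e n t * e n t) <= w.
  apply: (@le_trans _ _ (Rintegral mu D (fun _ => B ^+ 2))); last first.
    by rewrite lerDl.
  apply: le_Rintegral => //; first by apply: bmi; exact: bmM.
    by apply: bmi; split; [exact: measurable_cst|exists `|B ^+ 2|].
  move=> t Dt; rewrite -expr2 -real_normK ?num_real//.
  by rewrite lerXn2r// ?nnegrE//; [exact: le_trans (eB n t Dt)|exact: eB].
pose r := fix r n : T -> R :=
  if n is k.+1 then fun t => r k t + (- (a k / w)) * e k t else h.
have bmr n : bm (r n).
  by elim: n => [|n IH]//=; apply: bmD => //; exact: bmZ.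
(* The remainder keeps the coefficients that have not been removed yet. *)
have re n m : (n <= m)%N -> Rintegral mu D (fun t => r n t * e m t) = a m.
  elim: n => [//|n IH] nm /=.
  transitivity (Rintegral mu D (fun t => r n t * e m t +
      (- (a n / w)) * (e n t * e m t))).
    by apply: eq_Rintegral => t _; rewrite mulrDl mulrA.
  rewrite RintegralD//; [|by apply: bmi; exact: bmM|]; last first.
    by apply: bmi; apply: bmZ; exact: bmM.
  rewrite RintegralZl//; last by apply: bmi; exact: bmM.
  by rewrite IH ?(ltnW nm)// orth ?mulr0 ?addr0// neq_ltn nm.
have rr n : Rintegral mu D (fun t => r n.+1 t * r n.+1 t) <=
    Rintegral mu D (fun t => r n t * r n t) - a n ^+ 2 / w.
  have -> : Rintegral mu D (fun t => r n.+1 t * r n.+1 t) =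
     Rintegral mu D (fun t => (r n t * r n t + (- (2 * (a n / w))) * (r n t * e n t)) +
       (a n / w) ^+ 2 * (e n t * e n t)).
    by apply: eq_Rintegral => t _ /=; ring.
  rewrite RintegralD//; last 2 first.
  - by apply/bmi/bmD; [exact: bmM|apply/bmZ/bmM].
  - by apply/bmi/bmZ/bmM.
  rewrite RintegralD//; last 2 first.
  - by apply/bmi/bmM.
  - by apply/bmi/bmZ/bmM.
  rewrite RintegralZl//; last by apply/bmi/bmM.
  rewrite RintegralZl//; last by apply/bmi/bmM.
  rewrite re// -addrA lerD2l.
  apply: (@le_trans _ _ (- (2 * (a n / w)) * a n + (a n / w) ^+ 2 * w)).
    by rewrite lerD2l ler_wpM2l// sqr_ge0.
  rewrite le_eqVlt; apply/orP; left; apply/eqP; field.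
  exact: lt0r_neq0.
have sumle n : series (fun k => a k ^+ 2 / w) n <=
    Rintegral mu D (fun t => h t * h t) - Rintegral mu D (fun t => r n t * r n t).
  elim: n => [|n IH]; first by rewrite /series/= big_geq// subrr.
  rewrite seriesSr; have := rr n; move: IH; rewrite /=; lra.
have : (fun k => a k ^+ 2 / w) @ \oo --> (0 : R).
  apply: cvg_series_cvg_0; apply: nondecreasing_is_cvgn.
    apply: nondecreasing_series => k _ _.
    by rewrite divr_ge0 ?sqr_ge0// ltW.
  exists (Rintegral mu D (fun t => h t * h t)) => _ [n _ <-].
  apply: (le_trans (sumle n)); rewrite gerBl; apply: Rintegral_ge0 => t _.
  by rewrite -expr2 sqr_ge0.
move=> /cvgrPdist_lt aw; apply/cvgrPdist_lt => eps eps0.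
have ew0 : 0 < eps ^+ 2 / w by rewrite divr_gt0// exprn_gt0.
near=> n.
have : `|0 - a n ^+ 2 / w| < eps ^+ 2 / w by near: n; exact: aw.
rewrite !sub0r !normrN normrM (gtr0_norm (_ : 0 < w^-1)) ?invr_gt0//.
rewrite ltr_pM2r ?invr_gt0// normrX ltr_pXn2r ?nnegrE// ltW.
Unshelve. all: by end_near.
Qed.

(** Mercer's theorem. The bounded case applies to the truncations [hc k] of [h],
and replacing [h] by [hc k] changes all the coefficients by at most [B] times the
[L^1] distance of [h] and [hc k], which is small for large [k] whatever [n] is. *)
Lemma integrable_coef_cvg0 d (T : measurableType d) (R : realType)
    (mu : {measure set T -> \bar R}) (D : set T) (h : T -> R)
    (e : nat -> T -> R) (B : R) :
  measurable D -> (mu D < +oo)%E -> mu.-integrable D (EFin \o h) ->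
  (forall n, measurable_fun D (e n)) ->
  (forall n t, D t -> `|e n t| <= B) ->
  (forall m n, m != n -> Rintegral mu D (fun t => e m t * e n t) = 0) ->
  Rintegral mu D (fun t => h t * e n t) @[n --> \oo] --> (0 : R).
Proof.
move=> mD Doo hi me eB orth.
have mh : measurable_fun D h by apply/measurable_EFinP; exact: measurable_int hi.
pose hc (k : nat) (t : T) : R := Num.max (- k%:R) (Num.min (h t) k%:R).
have mhc k : measurable_fun D (hc k).
  by apply: measurable_maxr => //; exact: measurable_minr.
have hck k t : `|hc k t| <= k%:R.
  have := ler0n R k; rewrite /hc; move: k%:R => K K0.
  rewrite ler_norml /Num.max /Num.min.
  by do ! case: ifP => /=; rewrite ?lexx ?andbT //=; lra.
(* Domination for the convergence of [hc k] to [h] in [L^1]. *)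
have hch k t : `|h t - hc k t| <= `|h t|.
  have := ler0n R k; rewrite /hc /Num.max /Num.min; move: k%:R => K K0.
  case: (ltP (h t) K) => h1.
    case: (ltP (- K) (h t)) => h2; first by rewrite subrr normr0.
    by rewrite !ler0_norm; lra.
  by case: ltP => h2; rewrite !ger0_norm; lra.
have mhB k : measurable_fun D (fun t => `|h t - hc k t|).
  by apply: measurableT_comp => //; exact: measurable_funB.
have hBi k : mu.-integrable D (EFin \o (fun t => `|h t - hc k t|)).
  apply: (le_integrable_EFin _ _ _ _ D _ (fun t => `|h t|)) => //.
    by move=> t _; rewrite normr_id.
  exact: integrable_norm.
have dom : Rintegral mu D (fun t => `|h t - hc k t|) @[k --> \oo] --> (0 : R).
  have [] := @dominated_convergence _ _ _ mu D mD
    (fun k t => (`|h t - hc k t|)%:E) (cst 0%E) (fun t => (`|h t|)%:E).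
  - by move=> k; exact/measurable_EFinP.
  - exact: measurable_cst.
  - apply: aeW => t Dt; apply: cvg_near_cst.
    near=> k; congr EFin.
    have : `|h t| < k%:R by near: k; exact: nbhs_infty_gtr.
    rewrite ltr_norml => /andP[h1 h2].
    by rewrite /hc /Num.min h2 /Num.max h1 subrr normr0.
  - exact: integrable_norm.
  - by apply: aeW => t k Dt /=; rewrite lee_fin normr_id.
  move=> _ _; rewrite integral0 => H.
  exact: (fine_cvg H).
apply/cvgrPdist_lt => eps eps0.
have B0 : 0 < `|B| + 1 by rewrite ltr_wpDl.
have e2 : 0 < eps / 2 / (`|B| + 1) by rewrite !divr_gt0.
move/cvgrPdist_lt : dom => /(_ _ e2)[k _ /(_ k (leqnn k))] /=.
rewrite sub0r normrN ger0_norm ?Rintegral_ge0// => hk.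
have := bounded_coef_cvg0 _ _ _ mu D (hc k) e k%:R B mD Doo (mhc k) me
  (fun t _ => hck k t) eB orth.
move/cvgrPdist_lt => /(_ (eps / 2)) H.
near=> n.
have : `|0 - Rintegral mu D (fun t => hc k t * e n t)| < eps / 2.
  by near: n; apply: H; rewrite divr_gt0.
rewrite !sub0r !normrN => Hn.
have hei : mu.-integrable D (EFin \o (fun t => (h t - hc k t) * e n t)).
  apply: (le_integrable_EFin _ _ _ _ D _ (fun t => `|B| * `|h t - hc k t|)) => //.
  - by apply: measurable_funM => //; exact: measurable_funB.
  - move=> t Dt; rewrite normrM mulrC ler_wpM2r//.
    exact: le_trans (eB n t Dt) (ler_norm _).
  - exact: integrableZl (hBi k).
have hcei : mu.-integrable D (EFin \o (fun t => hc k t * e n t)).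
  apply: (bounded_integrable _ _ _ _ _ _ (k%:R * B)) => //.
    exact: measurable_funM.
  by move=> t Dt; rewrite normrM ler_pM// eB.
have -> : Rintegral mu D (fun t => h t * e n t) =
    Rintegral mu D (fun t => hc k t * e n t + (h t - hc k t) * e n t).
  by apply: eq_Rintegral => t _; ring.
rewrite RintegralD//; apply: (le_lt_trans (ler_normD _ _)).
rewrite [ltRHS]splitr ltrD//.
apply: (le_lt_trans (le_normr_Rintegral mD hei)).
apply: (@le_lt_trans _ _ ((`|B| + 1) * Rintegral mu D (fun t => `|h t - hc k t|))).
  rewrite -RintegralZl//; apply: le_Rintegral => //.
  - exact: integrable_norm.
  - exact: integrableZl (hBi k).
  - move=> t Dt; rewrite normrM mulrC ler_wpM2r//.
    by rewrite (le_trans (eB n t Dt))// (le_trans (ler_norm _))// lerDl.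
by rewrite mulrC -ltr_pdivlMr.
Unshelve. all: by end_near.
Qed.

(** * The completed Lebesgue measure *)

Lemma measurable_LebT (R : realType) (A : set R) :
  measurable A -> measurable (A : set (LebT R)).
Proof. by move=> mA; exact: sub_caratheodory. Qed.

Lemma measurable_itv_LebT (R : realType) (i : interval R) :
  measurable ([set` i] : set (LebT R)).
Proof. by apply: measurable_LebT; exact: measurable_itv. Qed.

Lemma measurable_fun_LebT (R : realType) d (T : measurableType d) (A : set R)
    (g : R -> T) : measurable A ->
  measurable_fun A g -> measurable_fun (A : set (LebT R)) g.
Proof. by move=> mA mg _ Y mY; apply: measurable_LebT; exact: mg. Qed.

Lemma continuous_measurable_LebT (R : realType) (E : set R) (g : R -> R) :
  measurable (E : set (LebT R)) -> continuous g ->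
  @measurable_fun _ _ (LebT R) R E g.
Proof.
move=> mE cg; apply: (@measurable_funS _ _ (LebT R) R setT).
- exact: measurableT.
- exact: subsetT.
- by apply: measurable_fun_LebT => //; exact: continuous_measurable_fun.
Qed.

Lemma Leb_itv_fin (R : realType) (a b : R) (l r : bool) :
  (Leb R [set` Interval (BSide l a) (BSide r b)] < +oo)%E.
Proof.
have -> : Leb R [set` Interval (BSide l a) (BSide r b)] =
  lebesgue_measure [set` Interval (BSide l a) (BSide r b)] by [].
by rewrite lebesgue_measure_itv/=; case: ifP; rewrite ?ltry// -EFinB ltry.
Qed.

(** Both measures agree on Borel sets, that is, Lebesgue measure on the Borel
sets is the image of the completed measure under the identity map. *)
Lemma integral_Leb (R : realType) (D : set R) (f : R -> \bar R) :
  measurable D -> measurable_fun setT f ->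
  (@lebesgue_measure R).-integrable D f ->
  (Leb R).-integrable D f /\
  (\int[Leb R]_(t in D) f t = \int[lebesgue_measure]_(t in D) f t)%E.
Proof.
move=> mD mf fi.
have mi : measurable_fun setT (id : LebT R -> measurableTypeR R).
  by apply: measurable_fun_LebT.
have E (g : measurableTypeR R -> \bar R) : (\int[lebesgue_measure]_(t in D) g t =
    \int[pushforward (Leb R) (id : LebT R -> measurableTypeR R)]_(t in D) g t)%E.
  by apply: eq_measure_integral.
have fiL : (Leb R).-integrable D f.
  apply/integrableP; split.
    by apply: measurable_fun_LebT => //; exact: measurable_funTS.
  have /integrableP[_] := fi; rewrite E ge0_integral_pushforward //.
  by apply: measurableT_comp => //; exact: measurable_funTS.
by split => //; rewrite E (integral_pushforward mi mf).
Qed.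

Lemma FTC_Leb (R : realType) (F f : R -> R) (a b : R) : a <= b ->
  (forall t : R, is_derive t 1 F (f t)) -> continuous f ->
  (Leb R).-integrable `[a, b]%classic (EFin \o f) /\
  Rintegral (Leb R) `[a, b]%classic f = F b - F a.
Proof.
move=> ab dF cf.
have mf : measurable_fun setT (EFin \o f).
  by apply/measurable_EFinP; exact: continuous_measurable_fun.
have fi : (@lebesgue_measure R).-integrable `[a, b]%classic (EFin \o f).
  apply: continuous_compact_integrable; first exact: segment_compact.
  exact: continuous_subspaceT.
have [fiL E] := integral_Leb R `[a, b]%classic _ (measurable_itv _) mf fi.
split => //; rewrite /Rintegral E.
move: ab; rewrite le_eqVlt => /predU1P[<-|ab].
  by rewrite set_itv1 integral_set1 subrr.
have cF : continuous F.
  by move=> t; apply: differentiable_continuous; apply/derivable1_diffP.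
rewrite (continuous_FTC2 ab (F := F)) //.
- exact: continuous_subspaceT.
- split => //.
  + by apply: cvg_at_right_filter; exact: cF.
  + by apply: cvg_at_left_filter; exact: cF.
- by move=> t _; rewrite derive1E; apply: derive_val.
Qed.

(** Open endpoints are what the two halves of a symmetric shell have. *)
Lemma FTC_Leb_oo (R : realType) (F f : R -> R) (a b : R) : a <= b ->
  (forall t : R, is_derive t 1 F (f t)) -> continuous f ->
  (Leb R).-integrable `]a, b[%classic (EFin \o f) /\
  Rintegral (Leb R) `]a, b[%classic f = F b - F a.
Proof.
move=> ab dF cf.
have [fi <-] := FTC_Leb R F f a b ab dF cf.
have mf : measurable_fun setT (EFin \o f).
  by apply/measurable_EFinP; exact: continuous_measurable_fun.
have lfi : (@lebesgue_measure R).-integrable `[a, b]%classic (EFin \o f).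
  apply: continuous_compact_integrable; first exact: segment_compact.
  exact: continuous_subspaceT.
have lfio : (@lebesgue_measure R).-integrable `]a, b[%classic (EFin \o f).
  apply: integrableS lfi => //; exact: subset_itv_oo_cc.
have [_ E1] := integral_Leb R `[a, b]%classic _ (measurable_itv _) mf lfi.
have [fio E2] := integral_Leb R `]a, b[%classic _ (measurable_itv _) mf lfio.
split => //; rewrite /Rintegral E1 E2; congr fine.
by rewrite integral_itv_bndoo//; exact: measurable_funTS.
Qed.

(** Continuity of the integral in its left endpoint. The condition [g a = 0] lets
the truncated integrands converge at every point of the interval, [a] included:
[a] itself lies in none of the truncated intervals. *)
Lemma Rintegral_truncl_cvg (R : realType) (g : R -> R) (a b : R) :
  (Leb R).-integrable `[a, b]%classic (EFin \o g) -> g a = 0 ->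
  Rintegral (Leb R) `[a + eps, b]%classic g @[eps --> 0^'+] -->
  Rintegral (Leb R) `[a, b]%classic g.
Proof.
move=> gi ga0.
have mD : measurable (`[a, b]%classic : set (LebT R)) by exact: measurable_itv_LebT.
apply/cvg_at_rightP => u [u0 ucvg].
pose E n := [set` `[a + u n, b]] : set (LebT R).
have mE n : measurable (E n) by exact: measurable_itv_LebT.
have RE n : Rintegral (Leb R) `[a + u n, b]%classic g =
    Rintegral (Leb R) `[a, b]%classic (g \_ (E n)).
  rewrite -Rintegral_mkcondr; congr (Rintegral _ _ _).
  apply/esym/setIidPr => t; rewrite /E/= !in_itv/= => /andP[h ->].
  by rewrite andbT (le_trans _ h)// lerDl ltW.
have mg : measurable_fun (`[a, b]%classic : set (LebT R)) g.
  by apply/measurable_EFinP; exact: measurable_int gi.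
have [] := @dominated_convergence _ _ _ (Leb R) _ mD
    (fun n t => ((g \_ (E n)) t)%:E) (EFin \o g) (fun t => (`|g t|)%:E).
- move=> n; apply/measurable_EFinP.
  apply/measurable_restrict => //.
  by apply: measurable_funS mg => //; exact: subIsetl.
- exact/measurable_EFinP.
- apply: aeW => t /=; rewrite in_itv /= => /andP[at1 tb].
  apply: cvg_near_cst.
  move: at1; rewrite le_eqVlt => /predU1P[<-|at1].
    apply: nearW => n; rewrite patchE; case: ifP => _ //.
    by rewrite ga0.
  near=> n; rewrite patchE; case: ifP => //.
  move/negP => []; apply/asboolP; rewrite /E /= in_itv /= tb andbT.
  rewrite -lerBrDl ltW//.
  near: n; move/cvgrPdist_lt : ucvg => /(_ (t - a)); rewrite subr_gt0 at1.
  move=> /(_ isT); apply: filterS => n.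
  by rewrite sub0r normrN gtr0_norm.
- exact: integrable_norm.
- apply: aeW => t n Dt /=; rewrite lee_fin patchE; case: ifP => _ //.
  by rewrite normr0.
move=> _ _ H.
rewrite (_ : (fun n => _) = fine \o (fun n => \int[Leb R]_(t in `[a, b]%classic)
    ((g \_ (E n)) t)%:E)%E); last by apply/funext => n; rewrite RE.
apply: fine_cvg; rewrite fineK//; exact: integrable_fin_num.
Unshelve. all: by end_near.
Qed.

(** * Invariance of the completed Lebesgue measure under reflections *)

Lemma lebesgue_measure_reflect_ocitv (R : realType) (a : R) (X : set R) :
  ocitv X ->
  lebesgue_measure ((fun t => a - t) @^-1` X) = lebesgue_measure X.
Proof.
move=> [[p q] _ <-] /=.
have -> : (fun t => a - t) @^-1` `]p, q]%classic = `[a - q, a - p[%classic.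
  apply/seteqP; split => t; rewrite /= !in_itv /= => /andP[h1 h2]; apply/andP.
    by rewrite lerBlDr -lerBlDl ltrBrDr -ltrBrDl //.
  by rewrite ltrBrDr -ltrBrDl lerBlDr -lerBlDl.
rewrite !lebesgue_measure_itv/= !lte_fin.
rewrite ltrD2l ltrN2; case: ifP => // _.
by rewrite -!EFinB; congr EFin; rewrite opprB addrC addrA subrK.
Qed.

(** The reflections of half-open intervals are half-open on the other side, so
the reflection of a cover of [A] is not a cover by the same kind of intervals.
But its members are Borel sets of unchanged measure, and countable subadditivity
of the outer measure suffices. *)
Lemma outer_Leb_reflect_le (R : realType) (a : R) (A : set R) :
  ((@wlength R idfun)^*%mu ((fun t => (a - t)%R) @^-1` A) <=
   (@wlength R idfun)^*%mu A)%E.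
Proof.
apply: le_ereal_inf_tmp => _ [F [mF AF] <-].
have FE k : (@wlength R idfun)^*%mu ((fun t => a - t) @^-1` (F k)) =
    wlength idfun (F k).
  rewrite -(@measurable_mu_extE _ _ _ (wlength idfun) _ (mF k)).
  exact: (@lebesgue_measure_reflect_ocitv R a (F k) (mF k)).
apply: (@le_trans _ _ ((@wlength R idfun)^*%mu
    (\bigcup_k ((fun t => a - t) @^-1` (F k))))).
  by apply: le_outer_measure => t /AF[k _ Fk]; exists k.
apply: (le_trans (outer_measure_sigma_subadditive _ _)).
apply: lee_nneseries => // k _.
by rewrite le_eqVlt; apply/orP; left; apply/eqP; exact: FE.
Qed.

Lemma outer_Leb_reflect (R : realType) (a : R) (A : set R) :
  (@wlength R idfun)^*%mu ((fun t => a - t) @^-1` A) =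
  (@wlength R idfun)^*%mu A.
Proof.
apply/eqP; rewrite eq_le outer_Leb_reflect_le/=.
have := outer_Leb_reflect_le _ a ((fun t => a - t) @^-1` A).
by rewrite -comp_preimage (_ : _ \o _ = id) //; apply/funext => t /=; rewrite subKr.
Qed.

(** Invariance of the outer measure carries the Caratheodory criterion for [Y],
tested on the reflection of [X], to the criterion for the reflection of [Y],
tested on [X]. *)
Lemma measurable_LebT_reflect (R : realType) (a : R) :
  measurable_fun setT ((fun t => a - t) : LebT R -> LebT R).
Proof.
move=> _ Y mY; rewrite setTI.
have {}mY : caratheodory_measurable (@wlength R idfun)^*%mu Y := mY.
suff : caratheodory_measurable (@wlength R idfun)^*%mu
  ((fun t => a - t) @^-1` Y) by [].
move=> X.
have XE : X = (fun t => a - t) @^-1` ((fun t => a - t) @^-1` X).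
  by rewrite -comp_preimage (_ : _ \o _ = id) //; apply/funext => t /=; rewrite subKr.
have [XY1 XY2] : X `&` (fun t => a - t) @^-1` Y =
    (fun t => a - t) @^-1` (((fun t => a - t) @^-1` X) `&` Y) /\
  X `&` ~` ((fun t => a - t) @^-1` Y) =
    (fun t => a - t) @^-1` (((fun t => a - t) @^-1` X) `&` ~` Y).
  by split; rewrite [in LHS]XE.
by rewrite XY1 XY2 !outer_Leb_reflect -(outer_Leb_reflect _ a X); exact: mY.
Qed.

Lemma Leb_reflect (R : realType) (a : R) (A : set (LebT R)) :
  pushforward (Leb R) ((fun t => a - t) : LebT R -> LebT R) A = Leb R A.
Proof. exact: outer_Leb_reflect. Qed.

(** The reflection is an involution, so measurability and integrability of [f]
follow from those of the reflected function, which are the ones at hand when [f]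
is known on one side only. *)
Lemma integral_Leb_reflect (R : realType) (a : R) (D : set (LebT R))
    (f : LebT R -> \bar R) :
  measurable D ->
  (Leb R).-integrable ((fun t => a - t) @^-1` D) (f \o (fun t => a - t)) ->
  (Leb R).-integrable D f /\
  (\int[Leb R]_(t in D) f t =
   \int[Leb R]_(t in (fun t => (a - t)%R) @^-1` D) f (a - t)%R)%E.
Proof.
move=> mD; set r : LebT R -> LebT R := fun t => a - t => fi.
have mr : measurable_fun setT (r : LebT R -> LebT R) := measurable_LebT_reflect R a.
have mE : measurable (r @^-1` D : set (LebT R)).
  by rewrite -[X in measurable X]setTI; exact: mr.
have rr t : r (r t) = t by rewrite /r subKr.
pose g : LebT R -> \bar R := f \_ D.
have fE : g \o r = (f \o r) \_ (r @^-1` D).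
  apply/funext => t; rewrite /patch /=.
  by congr (if _ then _ else _); apply/asboolP/asboolP.
have gi : (Leb R).-integrable setT (g \o r).
  by rewrite fE; exact/(integrable_mkcond _ mE).
have mf : measurable_fun setT g.
  have -> : g = (g \o r) \o r.
    by apply/funext => t /=; rewrite rr.
  by apply: measurableT_comp mr; exact: (measurable_int _ gi).
have LebE (h : LebT R -> \bar R) : (\int[Leb R]_t h t =
    \int[pushforward (Leb R) r]_t h t)%E.
  by apply: eq_measure_integral => A mA _; rewrite -[LHS](Leb_reflect _ a).
split.
  apply/(integrable_mkcond _ mD)/integrableP; split; first exact: mf.
  rewrite LebE.
  have /integrableP[_] := integrable_pushforward mr mf gi measurableT.
  exact.
rewrite integral_mkcond -/g LebE (integral_pushforward mr mf gi measurableT).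
by rewrite preimage_setT fE -integral_mkcond.
Qed.

Lemma Rintegral_Leb_reflect_itv (R : realType) (k : R -> R) (a p q : R) :
  (Leb R).-integrable `[a - q, a - p]%classic (EFin \o (fun t => k (a - t))) ->
  (Leb R).-integrable `[p, q]%classic (EFin \o k) /\
  Rintegral (Leb R) `[p, q]%classic k =
  Rintegral (Leb R) `[a - q, a - p]%classic (fun t => k (a - t)).
Proof.
have <- : (fun t => a - t) @^-1` `[p, q]%classic = `[a - q, a - p]%classic.
  by apply/seteqP; split => t; rewrite /= !in_itv /= => /andP[h1 h2]; lra.
move=> ki.
have [ki' E] := integral_Leb_reflect R a `[p, q]%classic (EFin \o k)
  (measurable_itv_LebT _ _) ki.
by split => //; rewrite /Rintegral; congr fine.
Qed.

(** * Trigonometric primitives *)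

Lemma normr_sin_le (R : realType) (z : R) : `|sin z| <= `|z|.
Proof.
wlog z0 : z / 0 <= z => [H|].
  case: (leP 0 z) => z0; first exact: H.
  by rewrite -[X in sin X]opprK sinN normrN -(normrN z); apply: H; rewrite oppr_ge0 ltW.
have [|w _] := @MVT_segment R sin cos 0 z z0 (fun t _ => is_derive_sin t).
  exact/continuous_subspaceT/continuous_sin.
rewrite sin0 !subr0 => ->; rewrite normrM ler_piMl//; exact: cos_max.
Qed.

Lemma continuous_sin_shift (R : realType) (u c : R) :
  continuous (fun t : R => sin (u * (t - c))).
Proof.
move=> t; apply: (@continuous_comp _ _ _ (fun t : R => u * (t - c)) sin).
  by apply: cvgM; [exact: cvg_cst|apply: cvgB; [exact: cvg_id|exact: cvg_cst]].
exact: continuous_sin.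
Qed.

Lemma continuous_cos_shift (R : realType) (u c : R) :
  continuous (fun t : R => cos (u * (t - c))).
Proof.
move=> t; apply: (@continuous_comp _ _ _ (fun t : R => u * (t - c)) cos).
  by apply: cvgM; [exact: cvg_cst|apply: cvgB; [exact: cvg_id|exact: cvg_cst]].
exact: continuous_cos.
Qed.

Lemma continuous_sin_mul (R : realType) (y : R) :
  continuous (fun s : R => sin (y * s)).
Proof.
have := continuous_sin_shift R y 0.
by rewrite (_ : (fun t : R => _) = (fun s => sin (y * s)))//;
  apply/funext => t; rewrite subr0.
Qed.

Lemma continuous_cos_mul (R : realType) (y : R) :
  continuous (fun s : R => cos (y * s)).
Proof.
have := continuous_cos_shift R y 0.
by rewrite (_ : (fun t : R => _) = (fun s => cos (y * s)))//;
  apply/funext => t; rewrite subr0.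
Qed.

Lemma is_derive_sinZ (R : realType) (a s : R) :
  is_derive s 1 (fun s : R => sin (a * s)) (a * cos (a * s)).
Proof.
have h := is_derive1_comp (is_derive_sin _) (is_deriveZ a (is_derive_id s (1 : R))).
by apply: (is_derive_eq h); rewrite /GRing.scale/= mulr1 mulrC.
Qed.

Lemma is_derive_cosZ (R : realType) (a s : R) :
  is_derive s 1 (fun s : R => cos (a * s)) (- a * sin (a * s)).
Proof.
have h := is_derive1_comp (is_derive_cos _) (is_deriveZ a (is_derive_id s (1 : R))).
by apply: (is_derive_eq h); rewrite /GRing.scale/=; ring.
Qed.

(** Lets primitives computed about [0] be used about [c]. *)
Lemma is_derive_shift (R : realType) (F : R -> R) (c t l : R) :
  is_derive (t - c) 1 F l -> is_derive t 1 (fun t => F (t - c)) l.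
Proof.
move=> dF.
have h := @is_derive1_comp _ F (fun t => t - c) _ _ _ dF
  (is_deriveB (is_derive_id t (1 : R)) (is_derive_cst c t 1)).
by apply: (is_derive_eq h); rewrite subr0 mulr1.
Qed.

(** A primitive of the product is
[(a sin (a t) cos (b t) - b cos (a t) sin (b t)) / (a^2 - b^2)]. It vanishes at
[0], and at [L] each of its terms has a factor that is assumed to vanish. *)
Lemma cos_orthogonal (R : realType) (a b c L : R) :
  0 <= L -> a ^+ 2 != b ^+ 2 -> cos (a * L) = 0 -> cos (b * L) = 0 ->
  Rintegral (Leb R) `[c, c + L]%classic
    (fun t => cos (a * (t - c)) * cos (b * (t - c))) = 0.
Proof.
move=> L0; rewrite -subr_eq0 => ab ca cb.
pose F (t : R) := (a ^+ 2 - b ^+ 2)^-1 *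
  (a * (sin (a * t) * cos (b * t)) - b * (cos (a * t) * sin (b * t))).
have dF (t : R) : is_derive t 1 F (cos (a * t) * cos (b * t)).
  have h1 := is_derive_sinZ R a t; have h2 := is_derive_cosZ R a t.
  have h3 := is_derive_sinZ R b t; have h4 := is_derive_cosZ R b t.
  have h5 := is_deriveM h1 h4; have h6 := is_deriveM h2 h3.
  have h7 := is_deriveB (is_deriveZ a h5) (is_deriveZ b h6).
  have h8 := is_deriveZ (a ^+ 2 - b ^+ 2)^-1 h7.
  by apply: (is_derive_eq h8); rewrite /GRing.scale /=; field.
have [||_ ->] := FTC_Leb R (fun t => F (t - c))
  (fun t => cos (a * (t - c)) * cos (b * (t - c))) c (c + L) _
  (fun t => is_derive_shift _ _ _ _ _ (dF (t - c))).
- by rewrite lerDl.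
- by move=> t; apply: cvgM; exact: continuous_cos_shift.
rewrite /F subrr !mulr0 sin0 (_ : c + L - c = L); last by ring.
by rewrite ca cb; ring.
Qed.

(** The primitive of [2 sin (y s) sin (u s)] in [s] that is usually written
[sin ((y - u) s) / (y - u) - sin ((y + u) s) / (y + u)], put over the common
denominator. In this form the terms that vanish when [cos (y s) = 0] and those
that are small with [u] can be read off. *)
Definition sin_sin_primitive (R : realType) (y u s : R) : R :=
  2 * (u * sin (y * s) * cos (u * s) - y * cos (y * s) * sin (u * s)) /
  (y ^+ 2 - u ^+ 2).

Lemma sin_sin_primitiveN (R : realType) (y u s : R) :
  sin_sin_primitive R y u (- s) = - sin_sin_primitive R y u s.
Proof.
rewrite /sin_sin_primitive !mulrN !sinN !cosN.
by move: (_^-1) => i; ring.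
Qed.

Lemma is_derive_sin_sin_primitive (R : realType) (y u s : R) :
  y ^+ 2 - u ^+ 2 != 0 ->
  is_derive s 1 (sin_sin_primitive R y u) (2 * sin (y * s) * sin (u * s)).
Proof.
move=> yu.
have h1 := is_derive_sinZ R y s; have h2 := is_derive_cosZ R y s.
have h3 := is_derive_sinZ R u s; have h4 := is_derive_cosZ R u s.
have h5 := is_deriveM h1 h4; have h6 := is_deriveM h2 h3.
have h7 := is_deriveB (is_deriveZ u h5) (is_deriveZ y h6).
have h8 := is_deriveZ (2 / (y ^+ 2 - u ^+ 2)) h7.
rewrite (_ : sin_sin_primitive R y u = (2 / (y ^+ 2 - u ^+ 2)) \*:
  (u \*: ((fun s0 : R => sin (y * s0)) * (fun s0 : R => cos (u * s0))) -
   y \*: ((fun s0 : R => cos (y * s0)) * (fun s0 : R => sin (u * s0))))).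
  apply: (is_derive_eq h8).
  rewrite /GRing.scale /=; field.
  exact: yu.
apply/funext => t; rewrite /sin_sin_primitive.
transitivity (2 / (y ^+ 2 - u ^+ 2) * (u * (sin (y * t) * cos (u * t)) -
  y * (cos (y * t) * sin (u * t)))); last by [].
by move: (_^-1) => i; ring.
Qed.

(** With [y = x - c] and [u = t - c]: the denominators [y^2 - u^2] are bounded
away from zero because [x] lies at distance more than [delta] from [c]. *)
Lemma gap_gt0 (R : realType) (y delta u : R) :
  delta < `|y| -> 0 <= u <= delta ->
  0 < y ^+ 2 - delta ^+ 2 /\ y ^+ 2 - delta ^+ 2 <= y ^+ 2 - u ^+ 2.
Proof.
move=> dy /andP[u0 ud]; have d0 := le_trans u0 ud; split.
  by rewrite subr_gt0 -(real_normK (num_real y)) ltrXn2r.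
by rewrite lerD2l lerN2 lerXn2r.
Qed.

(** By [`|sin z| <= `|z|] each of the two terms in the numerator is at most
[`|y| S u]. The bound is linear in [S], to make the lower endpoint negligible, and
linear in [u], to be integrable against [f]. *)
Lemma sin_sin_primitive_le (R : realType) (y delta u S : R) :
  delta < `|y| -> 0 <= u <= delta -> 0 <= S ->
  `|sin_sin_primitive R y u S| <= 4 * `|y| * S / (y ^+ 2 - delta ^+ 2) * u.
Proof.
move=> dy ud S0; have [g1 g2] := gap_gt0 R y delta u dy ud.
have g3 := lt_le_trans g1 g2.
have u0 : 0 <= u by case/andP: ud.
rewrite /sin_sin_primitive normrM normfV (gtr0_norm g3).
have H1 : `|u * sin (y * S) * cos (u * S)| <= `|y| * S * u.
  rewrite !normrM (ger0_norm u0) -mulrA mulrC; apply: ler_wpM2r => //.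
  rewrite -[leRHS]mulr1; apply: ler_pM => //; last exact: cos_max.
  by apply: (le_trans (normr_sin_le _ _)); rewrite normrM (ger0_norm S0).
have H2 : `|y * cos (y * S) * sin (u * S)| <= `|y| * S * u.
  rewrite !normrM -!mulrA; apply: ler_wpM2l => //.
  rewrite -[leRHS]mul1r; apply: ler_pM => //; first exact: cos_max.
  apply: (le_trans (normr_sin_le _ _)).
  by rewrite normrM (ger0_norm S0) (ger0_norm u0) mulrC.
apply: (@le_trans _ _ ((4 * `|y| * S * u) / (y ^+ 2 - delta ^+ 2))); last first.
  by rewrite le_eqVlt; apply/orP; left; apply/eqP; move: (_^-1) => i; ring.
apply: ler_pM => //.
- by rewrite invr_ge0 ltW.
- rewrite normrM ger0_norm//.
  have := ler_normB (u * sin (y * S) * cos (u * S))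
    (y * cos (y * S) * sin (u * S)); lra.
- by rewrite lef_pV2.
Qed.

(** * The Fourier transform of an odd function as a sine transform *)

Lemma cvg_real_complex (R : realType) (T : Type) (F : set_system T) (r : T -> R)
    (l : R) (z : R[i]) : Filter F ->
  r t @[t --> F] --> l ->
  (fun t => z * (r t)%:C : R[i]^o) @ F --> (z * l%:C : R[i]^o).
Proof.
move=> FF rl.
suff H : (fun t => (r t)%:C : R[i]^o) @ F --> (l%:C : R[i]^o).
  exact: (cvgM (cvg_cst _) H).
(* The radius ranges over positive complex numbers, which are real. *)
apply/cvgrPdist_lt => -[e e'].
rewrite ltcE /= => /andP[/eqP -> e0].
move/cvgrPdist_lt : rl => /(_ _ e0); apply: filterS => t.
by rewrite -rmorphB /= normc_def /= expr0n /= addr0 sqrtr_sqr ltcR.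
Qed.

(** The way in which the hypothesis on [f] is used throughout: a weight that
vanishes at least linearly at [c] makes [f] integrable. *)
Lemma weighted_integrable (R : realType) (c d : R) (f : R -> R)
    (E : set (LebT R)) (g : LebT R -> R) (K : R) :
  @measurable_fun _ _ (LebT R) R `[c, d]%classic f ->
  (Leb R).-integrable `[c, d]%classic
     (fun t : R => (`|f t| * `|t - c|)%:E) ->
  measurable E -> E `<=` `[c, d]%classic ->
  measurable_fun E g -> (forall t : R, E t -> `|g t| <= K * `|t - c|) ->
  (Leb R).-integrable E (EFin \o (fun t => g t * f t)).
Proof.
move=> mf fi mE ED mg gK.
have mD : measurable (`[c, d]%classic : set (LebT R)) by exact: measurable_itv_LebT.
apply: (le_integrable_EFin _ _ _ (Leb R) E (fun t => g t * f t)
  (fun t => K * (`|f t| * `|t - c|)) mE).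
- by apply: measurable_funM; [exact: mg|exact: measurable_funS mf].
- by move=> t Et; rewrite normrM mulrCA mulrC ler_wpM2l//; exact: gK.
- apply: (@integrableZl _ _ _ (Leb R) E mE K (fun t => (`|f t| * `|t - c|)%:E)).
  exact: integrableS fi.
Qed.

Lemma sine_integrable (R : realType) (c d : R) (f : R -> R) (s : R) :
  @measurable_fun _ _ (LebT R) R `[c, d]%classic f ->
  (Leb R).-integrable `[c, d]%classic
     (fun t : R => (`|f t| * `|t - c|)%:E) ->
  (Leb R).-integrable `[c, d]%classic
     (EFin \o (fun t : R => sin (s * (t - c)) * f t)).
Proof.
move=> mf fi.
apply: (weighted_integrable R c d f `[c, d]%classic (fun t => sin (s * (t - c)))
  `|s| mf fi).
- exact: measurable_itv_LebT.
- exact: subset_refl.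
- apply: continuous_measurable_LebT; first exact: measurable_itv_LebT.
  exact: continuous_sin_shift.
- by move=> t _; rewrite -normrM; exact: normr_sin_le.
Qed.

(** The phase is measured from [c], and the lower limit [a] is kept apart from
[c] so that the truncated integrals are covered too. *)
Definition sine_transform (R : realType) (c a b : R) (f : R -> R) (s : R) : R :=
  Rintegral (Leb R) `[a, b]%classic (fun t => sin (s * (t - c)) * f t).

Lemma sine_transformN (R : realType) (c d : R) (f : R -> R) (s : R) :
  @measurable_fun _ _ (LebT R) R `[c, d]%classic f ->
  (Leb R).-integrable `[c, d]%classic
     (fun t : R => (`|f t| * `|t - c|)%:E) ->
  sine_transform R c c d f (- s) = - sine_transform R c c d f s.
Proof.
move=> mf fi; rewrite -[RHS]mulN1r /sine_transform.
rewrite -(RintegralZl _ (measurable_itv_LebT _ _) (sine_integrable R c d f s mf fi)).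
by apply: eq_Rintegral => t _; rewrite mulNr sinN mulNr mulN1r.
Qed.

Lemma sine_transform_le (R : realType) (c d : R) (f : R -> R) (s : R) :
  @measurable_fun _ _ (LebT R) R `[c, d]%classic f ->
  (Leb R).-integrable `[c, d]%classic
     (fun t : R => (`|f t| * `|t - c|)%:E) ->
  `|sine_transform R c c d f s| <=
  `|s| * Rintegral (Leb R) `[c, d]%classic (fun t => `|f t| * `|t - c|).
Proof.
move=> mf fi.
have mD : measurable (`[c, d]%classic : set (LebT R)) by exact: measurable_itv_LebT.
have si := sine_integrable R c d f s mf fi.
apply: (le_trans (le_normr_Rintegral mD si)).
rewrite -(RintegralZl _ mD fi); apply: (le_Rintegral mD).
- exact: integrable_norm si.
- exact: integrableZl fi.
- move=> t _; rewrite normrM mulrCA mulrC; apply: ler_wpM2l; first exact: normr_ge0.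
  by rewrite -normrM; exact: normr_sin_le.
Qed.

(** The substitution [t -> 2 c - t] moves the left piece onto the right one, where
oddness replaces [f] by [- f]. With [s t = s c + s u] the kernels combine by
[cos (s c + s u) - cos (s c - s u) = - 2 sin (s c) sin (s u)] and
[sin (s c + s u) - sin (s c - s u) = 2 cos (s c) sin (s u)]; the prefactor is
[- 2 i e^(- i s c)]. *)
Lemma fourier_trunc_odd (R : realType) (c delta : R) (f : R -> R) (s eps : R) :
  odd_about c delta f ->
  @measurable_fun _ _ (LebT R) R `[c, c + delta]%classic f ->
  (Leb R).-integrable `[c, c + delta]%classic
     (fun t : R => (`|f t| * `|t - c|)%:E) ->
  0 < eps ->
  [/\ cintegrable (Leb R) `[c - delta, c - eps]%classic (fourier_integrand f s),
      cintegrable (Leb R) `[c + eps, c + delta]%classic (fourier_integrand f s) &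
      fourier_trunc f c delta s eps =
      ((- 2 * sin (s * c)) +i* (- 2 * cos (s * c))) *
      (sine_transform R c (c + eps) (c + delta) f s)%:C].
Proof.
move=> fodd mf fi eps0.
pose E : set (LebT R) := `[c + eps, c + delta]%classic.
have mE : measurable E by exact: measurable_itv_LebT.
have ED : E `<=` `[c, c + delta]%classic.
  move=> t; rewrite /E /= !in_itv/= => /andP[h ->]; rewrite andbT.
  by rewrite (le_trans _ h)// lerDl ltW.
have wi (g : R -> R) : continuous g -> (forall t, `|g t| <= 1) ->
    (Leb R).-integrable E (EFin \o (fun t => g t * f t)).
  move=> cg g1; apply: (weighted_integrable _ c (c + delta) f E g eps^-1) => //.
    exact: continuous_measurable_LebT.
  move=> t; rewrite /E /= in_itv/= => /andP[h _].
  rewrite (le_trans (g1 t))// mulrC ler_pdivlMr// mul1r.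
  by rewrite (le_trans _ (ler_norm _))// lerBrDl.
have csin := continuous_sin_shift R; have ccos := continuous_cos_shift R.
(* The phase is written [s * (t - 0)] to fit the lemmas on shifted arguments. *)
have ReE t : complex.Re (fourier_integrand f s t) = cos (s * (t - 0)) * f t.
  by rewrite /fourier_integrand /expi /= cosN subr0; ring.
have ImE t : complex.Im (fourier_integrand f s t) = (- 1) * (sin (s * (t - 0)) * f t).
  by rewrite /fourier_integrand /expi /= sinN subr0; ring.
have left (w : R -> R) : continuous w -> (forall t, `|w t| <= 1) ->
    (Leb R).-integrable `[c - delta, c - eps]%classic
      (EFin \o (fun t => w t * f t)) /\
    Rintegral (Leb R) `[c - delta, c - eps]%classic (fun t => w t * f t) =
    Rintegral (Leb R) E (fun t => - w (c + c - t) * f t).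
  move=> cw w1.
  have EE : `[c + c - (c - eps), c + c - (c - delta)]%classic = E.
    rewrite /E (_ : c + c - (c - eps) = c + eps); last by ring.
    by rewrite (_ : c + c - (c - delta) = c + delta) //; ring.
  have fE t : E t -> - w (c + c - t) * f t = w (c + c - t) * f (c + c - t).
    rewrite /E /= in_itv /= => /andP[h1 h2].
    have := fodd (t - c); rewrite (_ : c - (t - c) = c + c - t); last by ring.
    rewrite (_ : c + (t - c) = t); last by ring.
    by move=> ->; [rewrite mulNr mulrN|lra].
  have ci : continuous (fun t => - w (c + c - t)).
    move=> t; apply: cvgN; apply: (@continuous_comp _ _ _ (fun t : R => c + c - t) w).
      by apply: cvgB; [exact: cvg_cst|exact: cvg_id].
    exact: cw.
  have [] := Rintegral_Leb_reflect_itv R (fun t => w t * f t) (c + c)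
    (c - delta) (c - eps).
    rewrite EE.
    apply: (eq_integrable mE (EFin \o (fun t => - w (c + c - t) * f t))).
      by move=> t /set_mem Et /=; rewrite fE.
    by apply: wi => // t; rewrite normrN.
  rewrite EE => i1 ->; split => //.
  by apply: eq_Rintegral => t /set_mem Et; rewrite fE.
have s1 t : `|sin (s * (t - 0))| <= 1 by exact: sin_max.
have c1 t : `|cos (s * (t - 0))| <= 1 by exact: cos_max.
have [cl Ecl] := left _ (ccos s 0) c1.
have [sl Esl] := left _ (csin s 0) s1.
have cr := wi _ (ccos s 0) c1.
have sr := wi _ (csin s 0) s1.
have mL : measurable (`[c - delta, c - eps]%classic : set (LebT R)).
  exact: measurable_itv_LebT.
have ReEE : (fun t => complex.Re (fourier_integrand f s t)) =
   (fun t => cos (s * (t - 0)) * f t) by exact/funext.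
have ImEE : (fun t => complex.Im (fourier_integrand f s t)) =
   (fun t => (- 1) * (sin (s * (t - 0)) * f t)) by exact/funext.
have fE (A : set (LebT R)) : measurable A ->
    (Leb R).-integrable A (EFin \o (fun t => cos (s * (t - 0)) * f t)) ->
    (Leb R).-integrable A (EFin \o (fun t => sin (s * (t - 0)) * f t)) ->
    cintegrable (Leb R) A (fourier_integrand f s).
  move=> mA ci si; split.
    have -> : (fun t => (complex.Re (fourier_integrand f s t))%:E) =
      EFin \o (fun t => cos (s * (t - 0)) * f t) by apply/funext => t; rewrite ReE.
    exact: ci.
  have -> : (fun t => (complex.Im (fourier_integrand f s t))%:E) =
      (fun t => (- 1)%:E * (sin (s * (t - 0)) * f t)%:E)%E.
    by apply/funext => t; rewrite ImE.
  exact: integrableZl si.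
split; [exact: fE|exact: fE|].
have si : (Leb R).-integrable E (EFin \o (fun t => sin (s * (t - c)) * f t)).
  by apply: wi; [exact: csin|move=> t; exact: sin_max].
have Q1 : Rintegral (Leb R) E (fun t => - cos (s * (c + c - t - 0)) * f t) +
    Rintegral (Leb R) E (fun t => cos (s * (t - 0)) * f t) =
    (- 2 * sin (s * c)) * sine_transform R c (c + eps) (c + delta) f s.
  rewrite -RintegralD//; last first.
    rewrite (_ : (fun t => _) = (fun t => - cos (- s * (t - (c + c))) * f t)).
      apply: wi; first by move=> t; apply: cvgN; exact: ccos.
      by move=> t; rewrite normrN cos_max.
    by apply/funext => t; congr (- cos _ * _); ring.
  rewrite -RintegralZl//; apply: eq_Rintegral => t _.
  rewrite !subr0 (_ : s * (c + c - t) = s * c - s * (t - c)); last by ring.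
  rewrite [X in cos X * _](_ : s * t = s * c + s * (t - c)); last by ring.
  by rewrite cosB cosD; ring.
have Q2 : Rintegral (Leb R) E (fun t => - sin (s * (c + c - t - 0)) * f t) +
    Rintegral (Leb R) E (fun t => sin (s * (t - 0)) * f t) =
    (2 * cos (s * c)) * sine_transform R c (c + eps) (c + delta) f s.
  rewrite -RintegralD//; last first.
    rewrite (_ : (fun t => _) = (fun t => - sin (- s * (t - (c + c))) * f t)).
      apply: wi; first by move=> t; apply: cvgN; exact: csin.
      by move=> t; rewrite normrN sin_max.
    by apply/funext => t; congr (- sin _ * _); ring.
  rewrite -RintegralZl//; apply: eq_Rintegral => t _.
  rewrite !subr0 (_ : s * (c + c - t) = s * c - s * (t - c)); last by ring.
  rewrite [X in sin X * _](_ : s * t = s * c + s * (t - c)); last by ring.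
  by rewrite sinB sinD; ring.
rewrite /fourier_trunc /cintegral ReEE ImEE -/E !RintegralZl// Ecl Esl.
set X := sine_transform _ _ _ _ _ _ in Q1 Q2 *.
apply/eqP; rewrite eq_complex /= !mulr0 subr0 add0r.
rewrite Q1 -mulrDr Q2; apply/andP; split; apply/eqP; ring.
Qed.

(** Only after the two pieces have been combined can the truncation be removed:
each piece alone need not converge. *)
Lemma fourier_pv_odd (R : realType) (c delta : R) (f : R -> R) (s : R) :
  odd_about c delta f ->
  @measurable_fun _ _ (LebT R) R `[c, c + delta]%classic f ->
  (Leb R).-integrable `[c, c + delta]%classic
     (fun t : R => (`|f t| * `|t - c|)%:E) ->
  fourier_pv_exists f c delta s /\
  fourier_pv f c delta s =
      ((- 2 * sin (s * c)) +i* (- 2 * cos (s * c))) *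
      (sine_transform R c c (c + delta) f s)%:C.
Proof.
move=> fodd mf fi.
set k := (_ +i* _).
have H : (fourier_trunc f c delta s eps @[eps --> 0^'+] -->
    (k * (sine_transform R c c (c + delta) f s)%:C : R[i]^o)).
  have : (fun eps => k * (sine_transform R c (c + eps) (c + delta) f s)%:C : R[i]^o)
      @ 0^'+ --> (k * (sine_transform R c c (c + delta) f s)%:C : R[i]^o).
    apply: cvg_real_complex; apply: Rintegral_truncl_cvg; last first.
      by rewrite subrr mulr0 sin0 mul0r.
    exact: sine_integrable.
  apply: cvg_trans; apply: near_eq_cvg.
  near=> eps.
  have eps0 : 0 < eps by near: eps; exact: nbhs_right_gt.
  by have [_ _ ->] := fourier_trunc_odd R c delta f s eps fodd mf fi eps0.
have E : fourier_pv f c delta s = k * (sine_transform R c c (c + delta) f s)%:C.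
  have hR : hausdorff_space R[i]^o := @norm_hausdorff _ R[i]^o.
  exact: (cvg_lim hR H).
split; last exact: E.
split; last by rewrite E; exact: H.
move=> eps eps0.
have [i1 i2 _] := fourier_trunc_odd R c delta f s eps fodd mf fi eps0.
by split; [exact: i1|exact: i2].
Unshelve. all: by end_near.
Qed.

(** * Integrals over symmetric shells *)

Lemma symmetric_shellE (R : realType) (S T : R) : 0 <= S ->
  symmetric_shell S T = `]- T, - S[%classic `|` `]S, T[%classic.
Proof.
move=> S0; apply/seteqP; split => s; rewrite /symmetric_shell /= !in_itv /=.
  move=> /andP[h1 h2]; case: (leP 0 s) => s0.
    by right; move: h1 h2; rewrite ger0_norm// => -> ->.
  by left; move: h1 h2; rewrite ltr0_norm//; lra.
by move=> [/andP[h1 h2]|/andP[h1 h2]];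
  [rewrite ltr0_norm; lra|rewrite gtr0_norm; lra].
Qed.

Lemma measurable_symmetric_shell (R : realType) (S T : R) : 0 <= S ->
  measurable (symmetric_shell S T : set (LebT R)).
Proof.
move=> S0; rewrite symmetric_shellE//.
by apply: measurableU; exact: measurable_itv_LebT.
Qed.

Lemma Leb_symmetric_shell_fin (R : realType) (S T : R) : 0 <= S ->
  (Leb R (symmetric_shell S T) < +oo)%E.
Proof.
move=> S0; apply: (@le_lt_trans _ _ (Leb R `[- T, T]%classic)).
  apply: le_measure; rewrite ?inE.
  - exact: measurable_symmetric_shell.
  - exact: measurable_itv_LebT.
  move=> s; rewrite /symmetric_shell /= in_itv /= -ler_norml => /andP[_ h].
  exact: ltW.
exact: Leb_itv_fin.
Qed.

Lemma Rintegral_shell_odd (R : realType) (g : R -> R) (S T : R) :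
  0 <= S -> (forall s, g (- s) = - g s) ->
  (Leb R).-integrable (symmetric_shell S T) (EFin \o g) ->
  Rintegral (Leb R) (symmetric_shell S T) g = 0.
Proof.
move=> S0 gN gi.
have mE : measurable (symmetric_shell S T : set (LebT R))
  by exact: measurable_symmetric_shell.
have EE : (fun t => 0 - t) @^-1` symmetric_shell S T = symmetric_shell S T.
  by apply/seteqP; split => t; rewrite /symmetric_shell /= sub0r normrN.
have gE : (fun t => g (0 - t)) = (fun t => (- 1) * g t).
  by apply/funext => t; rewrite sub0r gN mulN1r.
have I : Rintegral (Leb R) (symmetric_shell S T) g =
    - Rintegral (Leb R) (symmetric_shell S T) g.
  have [] := integral_Leb_reflect R 0 (symmetric_shell S T) (EFin \o g) mE.
    rewrite EE (_ : _ \o _ = (fun t => (- 1)%:E * (g t)%:E)%E).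
      exact: integrableZl gi.
    by apply/funext => t /=; rewrite sub0r gN -EFinM mulN1r.
  move=> _; rewrite EE => E; rewrite [LHS](congr1 fine E).
  rewrite -mulN1r -(RintegralZl _ mE gi) -gE.
  by [].
by move/eqP: I; rewrite -addr_eq0 -mulr2n mulrn_eq0 => /eqP.
Qed.

Lemma Rintegral_shell_sin_sin (R : realType) (y u S T : R) :
  y ^+ 2 - u ^+ 2 != 0 -> 0 <= S -> S <= T ->
  Rintegral (Leb R) (symmetric_shell S T)
    (fun s => 2 * sin (y * s) * sin (u * s)) =
  2 * (sin_sin_primitive R y u T - sin_sin_primitive R y u S).
Proof.
move=> yu S0 ST; rewrite symmetric_shellE//.
pose g (s : R) := 2 * sin (y * s) * sin (u * s).
have cg : continuous g.
  move=> t; apply: cvgM; last exact: continuous_sin_mul.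
  by apply: cvgM; [exact: cvg_cst|exact: continuous_sin_mul].
have dG s := is_derive_sin_sin_primitive R y u s yu.
have [|i1 E1] := FTC_Leb_oo R _ g (- T) (- S) _ dG cg; first by rewrite lerN2.
have [i2 E2] := FTC_Leb_oo R _ g S T ST dG cg.
rewrite Rintegral_setU//; first last.
- apply/disj_setPS => s; rewrite /= !in_itv /= => -[/andP[h1 h2] /andP[h3 h4]]; lra.
- rewrite -symmetric_shellE//; apply: (bounded_integrable _ _ _ _ _ _ 2).
  + exact: measurable_symmetric_shell.
  + exact: Leb_symmetric_shell_fin.
  + by apply: continuous_measurable_LebT => //; exact: measurable_symmetric_shell.
  + move=> s _; rewrite /g !normrM ger0_norm//.
    by rewrite -mulrA ler_piMr// mulr_ile1// ?sin_max.
- exact: measurable_itv_LebT.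
- exact: measurable_itv_LebT.
rewrite -/g E1 E2 !sin_sin_primitiveN; ring.
Qed.

(** On [E] the integrand [k s * sin (s (t - c)) * f t] is dominated by
[K T * (`|f t| * `|t - c|)], which is a product of an integrable function of [s]
and one of [t]. Fubini's theorem also gives the measurability in [s], from which
the integrability of the inversion integrand will follow. *)
Lemma sine_transform_fubini (R : realType) (c d : R) (f : R -> R)
    (E : set (LebT R)) (k : LebT R -> R) (K T : R) :
  @measurable_fun _ _ (LebT R) R `[c, d]%classic f ->
  (Leb R).-integrable `[c, d]%classic
     (fun t : R => (`|f t| * `|t - c|)%:E) ->
  measurable E -> (Leb R E < +oo)%E -> (forall s : R, E s -> `|s| <= T) ->
  measurable_fun E k -> (forall s : R, E s -> `|k s| <= K) ->
  measurable_fun E (fun s => k s * sine_transform R c c d f s) /\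
  Rintegral (Leb R) E (fun s => k s * sine_transform R c c d f s) =
  Rintegral (Leb R) `[c, d]%classic (fun t =>
    Rintegral (Leb R) E (fun s => k s * sin (s * (t - c))) * f t).
Proof.
move=> mf fi mE Efin ET mk kK.
set D : set (LebT R) := `[c, d]%classic.
have mD : measurable D by exact: measurable_itv_LebT.
(* Extension by zero, to integrate over the whole product space. *)
pose kE : LebT R -> R := k \_ E.
pose fD : LebT R -> R := f \_ D.
pose phi (p : LebT R * LebT R) : R := kE p.1 * (sin (p.1 * (p.2 - c)) * fD p.2).
have mid : measurable_fun setT (id : LebT R -> R).
  by apply: measurable_fun_LebT.
have m1 : measurable_fun setT (fun p : LebT R * LebT R => (p.1 : R)).
  by apply: measurableT_comp mid _; exact: measurable_fst.
have m2 : measurable_fun setT (fun p : LebT R * LebT R => (p.2 : R)).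
  by apply: measurableT_comp mid _; exact: measurable_snd.
have mphi : measurable_fun setT phi.
  apply: measurable_funM.
    apply: (measurableT_comp (f := kE)); last exact: measurable_fst.
    by apply/(measurable_restrictT _ mE).
  apply: measurable_funM.
    apply: (measurableT_comp (f := sin)
      (g := fun p : LebT R * LebT R => (p.1 : R) * ((p.2 : R) - c))).
      apply: continuous_measurable_fun; exact: continuous_sin.
    apply: measurable_funM; first exact: m1.
    by apply: measurable_funB; [exact: m2|exact: measurable_cst].
  apply: (measurableT_comp (f := fD)); last exact: measurable_snd.
  by apply/(measurable_restrictT _ mD).
pose a : LebT R -> R := (fun=> K * T) \_ E.
pose b : LebT R -> R := (fun t : R => `|f t| * `|t - c|) \_ D.
have ia : (Leb R).-integrable setT (EFin \o a).
  rewrite /a -restrict_EFin; apply/(integrable_mkcond _ mE).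
  by apply: (bounded_integrable _ _ _ _ _ _ `|K * T|).
have ib : (Leb R).-integrable setT (EFin \o b).
  by rewrite /b -restrict_EFin; apply/(integrable_mkcond _ mD).
have phib s t : `|phi (s, t)| <= a s * b t.
  rewrite /phi /a /b /kE /fD !patchE /=.
  case: ifPn => [/set_mem Es|_]; last by rewrite !mul0r normr0.
  case: ifPn => [/set_mem Dt|_]; last by rewrite !mulr0 normr0.
  rewrite normrM -mulrA; apply: ler_pM => //; first exact: kK.
  rewrite normrM mulrCA mulrC; apply: ler_wpM2l => //.
  apply: (le_trans (normr_sin_le _ _)); rewrite normrM.
  by rewrite ler_wpM2r//; exact: ET.
have [mF FF] := Rintegral_fubini _ _ _ _ R (Leb R) (Leb R) phi a b mphi phib ia ib.
have E2 s : Rintegral (Leb R) setT (fun t => phi (s, t)) =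
    ((fun s => k s * sine_transform R c c d f s) \_ E) s.
  have -> : (fun t => phi (s, t)) = (fun t => kE s * (sin (s * (t - c)) * f t)) \_ D.
    apply/funext => t; rewrite /phi /fD !patchE /=; case: ifP => _; first by [].
    by rewrite !mulr0.
  rewrite -Rintegral_mkcond (RintegralZl _ mD (sine_integrable R c d f s mf fi)).
  rewrite /kE !patchE; case: ifP => _; first by [].
  by rewrite mul0r.
have ki (t : R) : (Leb R).-integrable E (EFin \o (fun s : R => k s * sin (s * (t - c)))).
  apply: (bounded_integrable _ _ _ _ E (fun s : R => k s * sin (s * (t - c))) K mE Efin).
    apply: measurable_funM; first exact: mk.
    apply: continuous_measurable_LebT; first exact: mE.
    rewrite (_ : (fun s => _) = (fun s : R => sin ((t - c) * s))).
      exact: continuous_sin_mul.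
    by apply/funext => s; rewrite mulrC.
  move=> s Es; rewrite normrM -[leRHS]mulr1; apply: ler_pM.
  - exact: normr_ge0.
  - exact: normr_ge0.
  - exact: kK.
  - exact: sin_max.
have E1 t : Rintegral (Leb R) setT (fun s => phi (s, t)) =
   ((fun t => Rintegral (Leb R) E (fun s => k s * sin (s * (t - c))) * f t) \_ D) t.
  have -> : (fun s => phi (s, t)) = (fun s => (k s * sin (s * (t - c))) * fD t) \_ E.
    apply/funext => s; rewrite /phi /kE !patchE /=; case: ifP => _.
      exact: mulrA.
    by rewrite mul0r.
  rewrite -Rintegral_mkcond (RintegralZr _ mE (ki t)).
  rewrite /fD !patchE; case: ifP => _; first by [].
  by rewrite mulr0.
split.
  apply/(measurable_restrictT _ mE).
  have -> : (fun s => k s * sine_transform R c c d f s) \_ E =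
      (fun s => Rintegral (Leb R) setT (fun t => phi (s, t))).
    by apply/funext => s; rewrite E2.
  exact: mF.
rewrite Rintegral_mkcond [RHS]Rintegral_mkcond.
transitivity (Rintegral (Leb R) setT
  (fun s => Rintegral (Leb R) setT (fun t => phi (s, t)))).
  by congr (Rintegral _ _ _); apply/funext => s; rewrite E2.
rewrite FF.
by congr (Rintegral _ _ _); apply/funext => t; rewrite E1.
Qed.

(** * The cutoffs *)

Lemma cutoff_gt0 (R : realType) (c x : R) (n : nat) : x != c -> 0 < cutoff c x n.
Proof.
move=> xc; rewrite /cutoff divr_gt0// ?mulr_gt0// ?pi_gt0// ?ltr0n ?addn1//.
by rewrite normr_gt0 subr_eq0.
Qed.

Lemma cutoff_inj (R : realType) (c x : R) : x != c -> injective (cutoff c x).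
Proof.
move=> xc m n; rewrite /cutoff.
have y0 : 2 * `|x - c| != 0 by rewrite mulf_neq0// normr_eq0 subr_eq0.
have p0 : pi != 0 :> R by rewrite gt_eqF// pi_gt0.
move/(mulIf (invr_neq0 y0))/(mulIf p0)/eqP; rewrite eqr_nat eqn_add2r.
by rewrite eqn_mul2l => /eqP.
Qed.

(** The cutoffs are chosen so that [`|x - c| * cutoff c x n] runs through the
zeros [pi / 2 + n pi] of the cosine. *)
Lemma cos_cutoff_norm (R : realType) (c x : R) (n : nat) : x != c ->
  cos (`|x - c| * cutoff c x n) = 0.
Proof.
move=> xc; have y0 : `|x - c| != 0 by rewrite normr_eq0 subr_eq0.
have E : `|x - c| * cutoff c x n = pi / 2 + pi *+ n.
  rewrite /cutoff natrD natrM -mulr_natr; field.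
  exact: y0.
rewrite E.
elim: n {E} => [|n IH]; first by rewrite mulr0n addr0 cos_pihalf.
by rewrite [pi *+ n.+1]mulrSr addrA cosDpi IH oppr0.
Qed.

Lemma cos_cutoff (R : realType) (c x : R) (n : nat) : x != c ->
  cos ((x - c) * cutoff c x n) = 0.
Proof.
move=> xc; rewrite -(cos_cutoff_norm _ _ _ n xc).
by case: (leP 0 (x - c)) => z0; [rewrite ger0_norm|rewrite ltr0_norm// mulNr cosN].
Qed.

(** The cosines [cos (T_n (t - c))] are orthogonal on the interval of length
[`|x - c|], not on the one of length [delta]; hence the extension of [h] by zero. *)
Lemma riemann_lebesgue_cutoff (R : realType) (c x delta : R) (h : R -> R) :
  delta < `|x - c| -> 0 <= delta ->
  (Leb R).-integrable `[c, c + delta]%classic (EFin \o h) ->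
  Rintegral (Leb R) `[c, c + delta]%classic
    (fun t => h t * cos (cutoff c x n * (t - c))) @[n --> \oo] --> (0 : R).
Proof.
move=> dy d0 hi; have xc : x != c.
  by rewrite -subr_eq0 -normr_gt0 (le_lt_trans d0).
set D : set (LebT R) := `[c, c + delta]%classic.
set D' : set (LebT R) := `[c, c + `|x - c|]%classic.
have mD : measurable D by exact: measurable_itv_LebT.
have mD' : measurable D' by exact: measurable_itv_LebT.
have DD' : D `<=` D'.
  by move=> t; rewrite /D /D' /= !in_itv /=; lra.
have D'D : D' `&` D = D by exact/setIidPr.
pose e n (t : LebT R) : R := cos (cutoff c x n * (t - c)).
have me n : measurable_fun D' (e n).
  by apply: continuous_measurable_LebT; [exact: mD'|exact: continuous_cos_shift].
have hi' : (Leb R).-integrable D' (EFin \o (h \_ D)).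
  apply: (integrableS measurableT mD' (@subsetT _ _)).
  by rewrite -restrict_EFin; exact/(integrable_mkcond _ mD).
have orth m n : m != n -> Rintegral (Leb R) D' (fun t => e m t * e n t) = 0.
  move=> mn; apply: cos_orthogonal.
  - exact: normr_ge0.
  - rewrite eqrXn2 ?ltW ?cutoff_gt0//.
    by apply: contra mn => /eqP/(cutoff_inj _ _ _ xc) ->.
  - by rewrite mulrC; exact: cos_cutoff_norm.
  - by rewrite mulrC; exact: cos_cutoff_norm.
have := integrable_coef_cvg0 _ _ _ (Leb R) D' (h \_ D) e 1 mD'
  (Leb_itv_fin _ _ _ _ _) hi' me
  (fun n t _ => cos_max _) orth.
apply: cvg_trans; apply: near_eq_cvg; apply: nearW => n.
have E : Rintegral (Leb R) D (fun t => h t * cos (cutoff c x n * (t - c))) =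
    Rintegral (Leb R) D' (fun t => (h \_ D) t * e n t).
  rewrite -[in LHS]D'D Rintegral_mkcondr; congr (Rintegral _ _ _).
  by apply/funext => t; rewrite /e !patchE; case: ifP => _; rewrite ?mul0r.
by rewrite E.
Qed.

Lemma measurable_inv_gap (R : realType) (c y delta : R) :
  delta < `|y| ->
  @measurable_fun _ _ (LebT R) R `[c, c + delta]%classic
    (fun t : R => (y ^+ 2 - (t - c) ^+ 2)^-1).
Proof.
move=> dy; apply: measurable_fun_LebT; first exact: measurable_itv.
apply: subspace_continuous_measurable_fun; first exact: measurable_itv.
apply: continuous_in_subspaceT => t; rewrite inE /= in_itv /= => /andP[h1 h2].
have [|g1 g2] := gap_gt0 R y delta (t - c) dy; first by lra.
apply: cvgV; first by rewrite gt_eqF// (lt_le_trans g1).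
apply: cvgB; first exact: cvg_cst.
apply: (@continuous_comp _ _ _ (fun t : R => t - c) (fun v => v ^+ 2)).
  by apply: cvgB; [exact: cvg_id|exact: cvg_cst].
exact: exprn_continuous.
Qed.

(** The weight [w] serves to cover both the function [f(t) u / (y^2 - u^2)]
and its products with the cosines. *)
Lemma integrable_gap (R : realType) (c delta y : R) (f w : R -> R) :
  delta < `|y| ->
  @measurable_fun _ _ (LebT R) R `[c, c + delta]%classic f ->
  (Leb R).-integrable `[c, c + delta]%classic
     (fun t : R => (`|f t| * `|t - c|)%:E) ->
  continuous w -> (forall t, `|w t| <= 1) ->
  (Leb R).-integrable `[c, c + delta]%classic
    (EFin \o (fun t => (t - c) / (y ^+ 2 - (t - c) ^+ 2) * f t * w t)).
Proof.
move=> dy mf fi cw w1.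
have mD : measurable (`[c, c + delta]%classic : set (LebT R)).
  exact: measurable_itv_LebT.
have -> : (fun t => (t - c) / (y ^+ 2 - (t - c) ^+ 2) * f t * w t) =
    (fun t => ((t - c) / (y ^+ 2 - (t - c) ^+ 2) * w t) * f t).
  by apply/funext => t; move: (_^-1) => i; ring.
apply: (weighted_integrable R c (c + delta) f _ _ (y ^+ 2 - delta ^+ 2)^-1 mf fi mD).
- exact: subset_refl.
- apply: measurable_funM; last exact: continuous_measurable_LebT.
  apply: measurable_funM; last exact: measurable_inv_gap.
  apply: continuous_measurable_LebT; first exact: mD.
  by move=> t; apply: cvgB; [exact: cvg_id|exact: cvg_cst].
- move=> t; rewrite /= in_itv /= => tcd.
  have [|g1 g2] := gap_gt0 R y delta (t - c) dy; first by lra.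
  have g3 := lt_le_trans g1 g2.
  rewrite normrM -[leRHS]mulr1.
  apply: ler_pM; [exact: normr_ge0|exact: normr_ge0| |exact: w1].
  rewrite normrM mulrC; apply: ler_wpM2r; first exact: normr_ge0.
  by rewrite normfV (gtr0_norm g3) lef_pV2.
Qed.

(** The two summands come from the two endpoints of the shell: at the cutoff the
primitive reduces to [2 u sin (y T) cos (u T) / (y^2 - u^2)], and at [S] it is
estimated by [sin_sin_primitive_le]. *)
Lemma Rintegral_shell_sine_transform_le (R : realType) (c delta : R)
    (f : R -> R) (x : R) (n : nat) (S : R) :
  0 <= delta -> delta < `|x - c| ->
  @measurable_fun _ _ (LebT R) R `[c, c + delta]%classic f ->
  (Leb R).-integrable `[c, c + delta]%classic
     (fun t : R => (`|f t| * `|t - c|)%:E) ->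
  0 <= S -> S <= cutoff c x n ->
  `|Rintegral (Leb R) (symmetric_shell S (cutoff c x n))
     (fun s => 2 * sin ((x - c) * s) * sine_transform R c c (c + delta) f s)| <=
  4 * `|Rintegral (Leb R) `[c, c + delta]%classic (fun t =>
       (t - c) / ((x - c) ^+ 2 - (t - c) ^+ 2) * f t * cos (cutoff c x n * (t - c)))| +
  8 * `|x - c| / ((x - c) ^+ 2 - delta ^+ 2) *
   Rintegral (Leb R) `[c, c + delta]%classic (fun t => `|f t| * `|t - c|) * S.
Proof.
move=> d0 dy mf fi S0 ST.
have xc : x != c by rewrite -subr_eq0 -normr_gt0 (le_lt_trans d0).
set T := cutoff c x n; set y := x - c.
set D : set (LebT R) := `[c, c + delta]%classic.
have mD : measurable D by exact: measurable_itv_LebT.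
have Dt t : D t -> 0 <= t - c <= delta.
  by rewrite /D /= in_itv /=; lra.
have gt0 t : D t -> 0 < y ^+ 2 - (t - c) ^+ 2.
  move=> /Dt tc; have [g1 g2] := gap_gt0 R y delta (t - c) dy tc.
  exact: lt_le_trans g2.
have mig := measurable_inv_gap R c y delta dy.
have msc (u : R) : measurable_fun D (fun t : R => sin (u * (t - c))).
  by apply: continuous_measurable_LebT; [exact: mD|exact: continuous_sin_shift].
have mcc (u : R) : measurable_fun D (fun t : R => cos (u * (t - c))).
  by apply: continuous_measurable_LebT; [exact: mD|exact: continuous_cos_shift].
have mtc : measurable_fun D (fun t : R => t - c).
  apply: continuous_measurable_LebT; first exact: mD.
  by move=> t; apply: cvgB; [exact: cvg_id|exact: cvg_cst].
pose h (t : R) := (t - c) / (y ^+ 2 - (t - c) ^+ 2) * f t * cos (T * (t - c)).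
have hi : (Leb R).-integrable D (EFin \o h).
  apply: integrable_gap => //; first exact: continuous_cos_shift.
  by move=> t; exact: cos_max.
pose g (t : R) := sin_sin_primitive R y (t - c) S.
have gi : (Leb R).-integrable D (EFin \o (fun t => g t * f t)).
  apply: (weighted_integrable R c (c + delta) f D _
    (4 * `|y| * S / (y ^+ 2 - delta ^+ 2)) mf fi mD).
  - exact: subset_refl.
  - apply: measurable_funM; last exact: mig.
    apply: measurable_funM; first exact: measurable_cst.
    apply: measurable_funB.
      apply: measurable_funM.
        by apply: measurable_funM; [exact: mtc|exact: measurable_cst].
      rewrite (_ : (fun t : LebT R => _) = (fun t : R => cos (S * (t - c)))).
        exact: mcc.
      by apply/funext => t; rewrite mulrC.
    apply: measurable_funM; first exact: measurable_cst.
    rewrite (_ : (fun t : LebT R => _) = (fun t : R => sin (S * (t - c)))).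
      exact: msc.
    by apply/funext => t; rewrite mulrC.
  - move=> t /Dt tc; rewrite (ger0_norm (_ : 0 <= t - c)); last by case/andP: tc.
    exact: sin_sin_primitive_le.
have mE : measurable (symmetric_shell S T : set (LebT R))
  by exact: measurable_symmetric_shell.
have kK (s : R) : symmetric_shell S T s -> `|2 * sin (y * s)| <= 2.
  by move=> _; rewrite normrM ger0_norm// ler_piMr// sin_max.
have [_ ->] := sine_transform_fubini R c (c + delta) f (symmetric_shell S T)
  (fun s => 2 * sin (y * s)) 2 T mf fi mE (Leb_symmetric_shell_fin _ _ _ S0)
  (fun s => fun hs => ltW (proj2 (andP hs)))
  (continuous_measurable_LebT _ _ _ mE
    (fun s => cvgM (cvg_cst _) (continuous_sin_mul R y s)))
  kK.
have -> : Rintegral (Leb R) D (fun t =>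
    Rintegral (Leb R) (symmetric_shell S T)
      (fun s => 2 * sin (y * s) * sin (s * (t - c))) * f t) =
  Rintegral (Leb R) D (fun t => (4 * sin (y * T)) * h t - 2 * (g t * f t)).
  apply: eq_Rintegral => t /set_mem tD.
  rewrite (_ : (fun s => 2 * sin (y * s) * sin (s * (t - c))) =
    (fun s => 2 * sin (y * s) * sin ((t - c) * s))); last first.
    by apply/funext => s; rewrite (mulrC s).
  rewrite Rintegral_shell_sin_sin//; last by rewrite gt_eqF// gt0.
  rewrite /g /h {1}/sin_sin_primitive (cos_cutoff _ _ _ _ xc) (mulrC (t - c) T) -/T.
  by move: (sin_sin_primitive _ _ _ _) => G; move: (_^-1) => i; ring.
rewrite (RintegralB mD); [|exact: integrableZl hi|exact: integrableZl gi].
rewrite (RintegralZl _ mD hi) (RintegralZl _ mD gi).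
apply: (le_trans (ler_normB _ _)); apply: lerD.
  rewrite !normrM ger0_norm//; apply: ler_wpM2r; first exact: normr_ge0.
  by rewrite ler_piMr// sin_max.
rewrite normrM ger0_norm//.
apply: (@le_trans _ _ (2 * ((4 * `|y| * S / (y ^+ 2 - delta ^+ 2)) *
    Rintegral (Leb R) D (fun t => `|f t| * `|t - c|)))); last first.
  rewrite le_eqVlt; apply/orP; left; apply/eqP.
  by move: (_^-1) (Rintegral _ _ _) => i J; ring.
apply: ler_wpM2l => //; apply: (le_trans (le_normr_Rintegral mD gi)).
rewrite -(RintegralZl _ mD fi); apply: (le_Rintegral mD).
- exact: integrable_norm gi.
- exact: integrableZl fi.
- move=> t /Dt tc; rewrite normrM mulrCA mulrC; apply: ler_wpM2l; first exact: normr_ge0.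
  rewrite (ger0_norm (_ : 0 <= t - c)); last by case/andP: tc.
  exact: sin_sin_primitive_le.
Qed.

Theorem theorem5p1 (R : realType) (c delta : R) (f : R -> R) (x : R)
    (delta_gt0 : 0 < delta)
    (f_odd : odd_about c delta f)
    (f_meas : @measurable_fun _ _ (LebT R) R `[c, c + delta]%classic f)
    (f_int : (Leb R).-integrable `[c, c + delta]%classic
       (fun t : R => (`|f t| * `|t - c|)%:E))
    (x_out : x \notin `[c - delta, c + delta]) :
  [/\ (forall s : R, fourier_pv_exists f c delta s),
      (forall (n : nat) (S : R), 0 < S ->
         cintegrable (Leb R) (symmetric_shell S (cutoff c x n))
           (inversion_integrand f c delta x)) &
      (fun p : nat * R =>
         cintegral (Leb R) (symmetric_shell p.2 (cutoff c x p.1))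
           (inversion_integrand f c delta x))
        @ (\oo, 0^'+) --> (0 : R[i]^o)].
Proof.
have dy : delta < `|x - c|.
  move: x_out; apply: contraNT; rewrite -leNgt ler_norml in_itv /= => /andP[h1 h2].
  by apply/andP; split; lra.
have d0 : 0 <= delta := ltW delta_gt0.
have xc : x != c by rewrite -subr_eq0 -normr_gt0 (le_lt_trans d0).
set y := x - c in dy.
set F := sine_transform R c c (c + delta) f.
have pv s := fourier_pv_odd R c delta f s f_odd f_meas f_int.
have ReE s : complex.Re (inversion_integrand f c delta x s) = 2 * sin (y * s) * F s.
  rewrite /inversion_integrand (proj2 (pv s)) /expi /= -/F.
  rewrite (_ : y * s = x * s - s * c); last by rewrite /y; ring.
  by rewrite sinB !mulr0; ring.
have ImE s : complex.Im (inversion_integrand f c delta x s) = (- 2 * cos (y * s)) * F s.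
  rewrite /inversion_integrand (proj2 (pv s)) /expi /= -/F.
  rewrite (_ : y * s = x * s - s * c); last by rewrite /y; ring.
  by rewrite cosB !mulr0; ring.
have wi (k : R -> R) (n : nat) (S : R) : 0 < S -> continuous k ->
    (forall s, `|k s| <= 2) ->
    (Leb R).-integrable (symmetric_shell S (cutoff c x n))
      (EFin \o (fun s => k s * F s)).
  move=> S0 ck k2; set T := cutoff c x n.
  have mE : measurable (symmetric_shell S T : set (LebT R)).
    by apply: measurable_symmetric_shell; exact: ltW.
  have Efin := Leb_symmetric_shell_fin R S T (ltW S0).
  have ET (s : R) : symmetric_shell S T s -> `|s| <= T.
    by move=> /andP[_ /ltW].
  have [mk _] := sine_transform_fubini R c (c + delta) f (symmetric_shell S T)
    k 2 T f_meas f_int mE Efin ET (continuous_measurable_LebT _ _ _ mE ck)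
    (fun s _ => k2 s).
  apply: (bounded_integrable _ _ _ (Leb R) (symmetric_shell S T) (fun s => k s * F s)
   (2 * (T * Rintegral (Leb R) `[c, c + delta]%classic
     (fun t => `|f t| * `|t - c|))) mE Efin mk).
  move=> s /ET sT; rewrite normrM; apply: ler_pM => //.
  apply: (le_trans (sine_transform_le R c (c + delta) f s f_meas f_int)).
  by apply: ler_wpM2r => //; apply: Rintegral_ge0 => t _; rewrite mulr_ge0.
have Rei n S : 0 < S -> (Leb R).-integrable (symmetric_shell S (cutoff c x n))
    (EFin \o (fun s => 2 * sin (y * s) * F s)).
  move=> S0; apply: wi => //.
    by move=> s; apply: cvgM; [exact: cvg_cst|exact: continuous_sin_mul].
  by move=> s; rewrite normrM ger0_norm// ler_piMr// sin_max.
have Imi n S : 0 < S -> (Leb R).-integrable (symmetric_shell S (cutoff c x n))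
    (EFin \o (fun s => (- 2 * cos (y * s)) * F s)).
  move=> S0; apply: wi => //.
    by move=> s; apply: cvgM; [exact: cvg_cst|exact: continuous_cos_mul].
  by move=> s; rewrite mulNr normrN normrM ger0_norm// ler_piMr// cos_max.
have ReEE : (fun s => complex.Re (inversion_integrand f c delta x s)) =
  (fun s => 2 * sin (y * s) * F s) by exact/funext.
have ImEE : (fun s => complex.Im (inversion_integrand f c delta x s)) =
  (fun s => (- 2 * cos (y * s)) * F s) by exact/funext.
split; first by move=> s; exact: (proj1 (pv s)).
  move=> n S S0; split.
    rewrite (_ : (fun s => _) = EFin \o (fun s => 2 * sin (y * s) * F s)).
      exact: Rei.
    by apply/funext => s /=; rewrite ReE.
  rewrite (_ : (fun s => _) = EFin \o (fun s => (- 2 * cos (y * s)) * F s)).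
    exact: Imi.
  by apply/funext => s /=; rewrite ImE.
pose r (p : nat * R) := Rintegral (Leb R) (symmetric_shell p.2 (cutoff c x p.1))
  (fun s => 2 * sin (y * s) * F s).
have cE n S : 0 < S ->
    cintegral (Leb R) (symmetric_shell S (cutoff c x n))
      (inversion_integrand f c delta x) =
    1 * (r (n, S))%:C.
  move=> S0; rewrite /cintegral ReEE ImEE mul1r.
  rewrite [X in _ +i* X](Rintegral_shell_odd R _ _ _ (ltW S0) _ (Imi n S S0)) //.
  by move=> s; rewrite mulrN cosN /F sine_transformN// mulrN.
pose h t := (t - c) / (y ^+ 2 - (t - c) ^+ 2) * f t.
have hi : (Leb R).-integrable `[c, c + delta]%classic (EFin \o h).
  have -> : h = (fun t => (t - c) / (y ^+ 2 - (t - c) ^+ 2) * f t * 1).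
    by apply/funext => t; rewrite mulr1.
  apply: (integrable_gap R c delta y f (fun=> 1) dy f_meas f_int).
    by move=> t; exact: cvg_cst.
  by move=> t; rewrite normr1.
have rl := riemann_lebesgue_cutoff R c x delta h dy d0 hi.
set C := 8 * `|x - c| / ((x - c) ^+ 2 - delta ^+ 2) *
   Rintegral (Leb R) `[c, c + delta]%classic (fun t => `|f t| * `|t - c|).
have rle n S : 0 < S -> S <= cutoff c x n -> `|r (n, S)| <=
   4 * `|Rintegral (Leb R) `[c, c + delta]%classic
     (fun t => h t * cos (cutoff c x n * (t - c)))| + C * S.
  move=> S0 ST; exact: Rintegral_shell_sine_transform_le R c delta f x n S
    d0 dy f_meas f_int (ltW S0) ST.
have C0 : 0 <= C.
  have [|g1 _] := gap_gt0 R y delta 0 dy; first by rewrite lexx.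
  rewrite /C mulr_ge0//; last first.
    by apply: Rintegral_ge0 => t _; rewrite mulr_ge0.
  by rewrite divr_ge0 ?mulr_ge0// ltW.
(* [S <= cutoff c x 0] gives [S <= cutoff c x n] for all [n] at once. *)
have T_ge n : cutoff c x 0 <= cutoff c x n.
  rewrite /cutoff ler_pM2r ?invr_gt0 ?mulr_gt0 ?normr_gt0 ?subr_eq0//.
  rewrite ler_pM2r ?pi_gt0// ler_nat muln0.
  exact: leq_addl.
have r0 : r p @[p --> (\oo, 0^'+)] --> (0 : R).
  apply/cvgrPdist_lt => eps eps0.
  move/cvgrPdist_lt : rl => /(_ (eps / 8)); rewrite divr_gt0// => /(_ isT) rl.
  (* Each of the two parts of the bound [rle] takes half of [eps]; the 1 in
     [C + 1] allows for [C = 0]. *)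
  have eC : 0 < eps / 2 / (C + 1) by rewrite !divr_gt0// ltr_wpDl.
  exists ([set n | `|0 - Rintegral (Leb R) `[c, c + delta]%classic
      (fun t => h t * cos (cutoff c x n * (t - c)))| < eps / 8],
    [set S : R | [/\ 0 < S, S <= cutoff c x 0 & S < eps / 2 / (C + 1)]]).
    split; first exact: rl.
    near=> S; split; first by near: S; exact: nbhs_right_gt.
    - by near: S; apply: nbhs_right_le; exact: cutoff_gt0.
    - by near: S; exact: nbhs_right_lt.
  move=> [n S] [/= an [S0 ST Se]].
  rewrite sub0r normrN; rewrite sub0r normrN in an.
  apply: (le_lt_trans (rle n S S0 (le_trans ST (T_ge n)))).
  have : C * S <= (C + 1) * S by rewrite ler_pM2r// lerDl.
  move: Se; rewrite ltr_pdivlMr; last by rewrite ltr_wpDl.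
  rewrite mulrC; lra.
have : (fun p => 1 * (r p)%:C : R[i]^o) @ (\oo, 0^'+) --> (1 * 0%:C : R[i]^o).
  exact: cvg_real_complex.
rewrite mulr0; apply: cvg_trans; apply: near_eq_cvg.
exists (setT, [set S : R | 0 < S]).
  by split; [exact: filterT|exact: nbhs_right_gt].
by move=> [n S] [_ /= S0]; rewrite cE.
Unshelve. all: by end_near.
Qed.
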